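(* Let $B$ be a symmetric endomorphism of a Euclidean vector space $V$, defining the Cahen-Wallach space $M_B$. A simple Clifford representation $\rho$ of $M_B$ (on the irreducible module) with $\rho(e_+)\neq0$ is only possible in even dimension ($\dim V$ even) and for $B=-2\lambda\,\mathrm{id}_V$. It is given, for a choice of upper or lower signs, by $$\rho(v^* )=-\sqrt2\,\lambda\begin{pmatrix}0&v\\0&0\end{pmatrix},\qquad \rho(e_+)=\sqrt2\,\alpha\begin{pmatrix}0&\Pi^\pm\\0&0\end{pmatrix},$$ $$\rho(e_-)=\rho_0\,\mathrm{id}+\begin{pmatrix}-\sqrt{2(\alpha\beta+\lambda)}\,\Pi^\mp+c'&\sqrt2\,(\beta\Pi^\mp+e_1+e_2+e_3)\\-\sqrt2\,\alpha\Pi^\mp&\sqrt{2(\alpha\beta+\lambda)}\,\Pi^\mp+d'\end{pmatrix},$$ $$\rho(v)=\begin{pmatrix}-\alpha\Pi^\pm v&\sqrt{\alpha\beta+\lambda}\;v+\frac1{\sqrt2}(c'v-vd')\\0&\alpha\Pi^\mp v\end{pmatrix}\qquad(v\in V),$$ where $\alpha,\beta,\rho_0$ are scalars and $c'=\Pi^\pm c'\Pi^\mp$, $d'=\Pi^\mp d'\Pi^\pm$, $e_1=\Pi^\pm e_1\Pi^\mp$, $e_2=\Pi^\mp e_2\Pi^\pm$, $e_3=\Pi^\pm e_3\Pi^\pm$ are elements of $\mathrm{C}\ell(V)$. The free parameters that describe the representation are the scalars $\alpha,\beta,\rho_0$ and the Clifford element $e_3$. The further contributions are related by $\sqrt2\,\alpha\,(e_1v+ve_2)=\sqrt{\alpha\beta+\lambda}\,(c'v-vd')$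 for all $v\in V$.
   Context: $V$ is an $n$-dimensional real vector space, $W=V\oplus\mathbb{R}e_+\oplus\mathbb{R}e_-$ carries the Lorentzian metric $\langle\cdot,\cdot\rangle$ with $g=\langle\cdot,\cdot\rangle|_V$ Euclidean, $e_\pm$ null and orthogonal to $V$, $\langle e_+,e_-\rangle=1$. Write $v^*=\langle v,\cdot\rangle\in V^*$. The Lie algebra of the Cahen-Wallach space $M_B$ is $V^*\oplus W$ with the only non-vanishing brackets $[v^*,w]=-\langle Bv,w\rangle e_+$, $[v^*,e_-]=Bv$, $[e_-,w]=w^*$ for $v,w\in V$. $\mathrm{C}\ell(V)$ is the complex Clifford algebra with $vw+wv=-2g(v,w)$, acting on an irreducible module $S(V)$. $\mathrm{C}\ell(W)$ acts on the irreducible module $S=S(V)\oplus S(V)$ by $2\times2$-matrices with entries in $\mathrm{C}\ell(V)$: $e_+\mapsto\begin{pmatrix}0&\sqrt2\\0&0\end{pmatrix}$, $e_-\mapsto\begin{pmatrix}0&0\\-\sqrt2&0\end{pmatrix}$, $v\mapsto\begin{pmatrix}-v&0\\0&v\end{pmatrix}$. A simple Clifford map of $M_B$ is a linear map $\rho:V^*\oplus W\to\mathrm{C}\ell(W)$, acting on $S$, whose restriction to $V^*$ is the spin representation $\rho(v^* )=\frac1{\sqrt2}\begin{pmatrix}0&Bv\\0&0\end{pmatrix}$ and which satisfies $\rho([v^*,x])=[\rho(v^* ),\rho(x)]$ for all $v^*\in V^*$, $x\in V^*\oplus W$. It is a Clifford representation if it is a representation of the Lie algebra $V^*\oplus W$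 on $S$. For even $n$ and an orthonormal basis with Clifford generators $\Gamma_1,\dots,\Gamma_n$, $\Gamma^*=i^{\lfloor (n+1)/2\rfloor}\Gamma_1\cdots\Gamma_n$ satisfies $(\Gamma^* )^2=1$, and $\Pi^\pm=\frac12(1\pm\Gamma^* )$.
   Formalization: Assumes dim V>0 and B nondegenerate (B=0 fails); c',d' enter rho(e_-) with minus signs; as scalar β and square root miss representations for n≥4, the family is shown for scalar chiral diagonal blocks, and the full classification takes β and the root in Π^∓Cl(V)Π^∓. *)

(* Defs.v *)
From HB Require Import structures.
From mathcomp Require Import all_boot all_order all_algebra.
From mathcomp Require Import reals.
From mathcomp.real_closed Require Import complex.

Set Implicit Arguments.
Unset Strict Implicit.
Unset Printing Implicit Defensive.

Import Order.TTheory GRing.Theory Num.Theory.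

Local Open Scope ring_scope.
Local Open Scope complex_scope.

(* V is R^n, as column vectors, with its standard Euclidean metric. *)
Definition eucl (R : realType) (n : nat) (v w : 'cV[R]_n) : R :=
  \sum_(i < n) v i 0 * w i 0.

Definition sqrt2 (R : realType) : R[i] := sqrtC 2.

(* The Lie algebra V^* + V + R e_+ + R e_-.  Elements of V^* are row vectors,
   so that v^* = <v, .> is the transpose of v. *)
Definition cw_algebra (R : realType) (n : nat) : lmodType R :=
  ('rV[R]_n * 'cV[R]_n * R^o * R^o)%type.

Definition star (R : realType) n (v : 'cV[R]_n) : cw_algebra R n :=
  (v^T, 0, 0, 0).
Definition vec (R : realType) n (v : 'cV[R]_n) : cw_algebra R n :=
  (0, v, 0, 0).
Definition eplus (R : realType) n : cw_algebra R n := (0, 0, 1, 0).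
Definition eminus (R : realType) n : cw_algebra R n := (0, 0, 0, 1).

(* The bilinear alternating extension of
   [v^*, w] = - <B v, w> e_+,  [v^*, e_-] = B v,  [e_-, w] = w^*. *)
Definition cw_bracket (R : realType) n (B : 'M[R]_n) (x y : cw_algebra R n) :
    cw_algebra R n :=
  let: (phi, v, _, s) := x in
  let: (psi, w, _, t) := y in
  (s *: w^T - t *: v^T,
   t *: (B *m phi^T) - s *: (B *m psi^T),
   eucl (B *m psi^T) v - eucl (B *m phi^T) w,
   0).

Definition real_linear (R : realType) (U : lmodType R) (m : nat)
    (f : U -> 'M[R[i]]_m) : Prop :=
  forall (a : R) (x y : U), f (a *: x + y) = a%:C *: f x + f y.

(* The unital algebra of operators generated by G. *)
Inductive generated (C : fieldType) (m : nat) (G : 'M[C]_m -> Prop) :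
    'M[C]_m -> Prop :=
| gen_in x : G x -> generated G x
| gen_one : generated G 1%:M
| gen_add x y : generated G x -> generated G y -> generated G (x + y)
| gen_scale a x : generated G x -> generated G (a *: x)
| gen_mul x y : generated G x -> generated G y -> generated G (x *m y).

(* gamma v is the operator by which v in V acts on the module S(V) = C^N. *)
Definition clifford_action (R : realType) (n N : nat)
    (gamma : 'cV[R]_n -> 'M[R[i]]_N) : Prop :=
  real_linear gamma /\
  forall v w,
    gamma v *m gamma w + gamma w *m gamma v = ((- 2 * eucl v w)%:C)%:M.

(* Operators act on column vectors from the left. *)
Definition irreducible_action (R : realType) (n N : nat)
    (gamma : 'cV[R]_n -> 'M[R[i]]_N) : Prop :=
  (0 < N)%N /\
  forall U : {vspace 'cV[R[i]]_N},
    (forall v x, x \in U -> gamma v *m x \in U) -> U = 0%VS \/ U = fullv.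

(* Elements of Cl(V), acting on S(V). *)
Definition in_ClV (R : realType) (n N : nat)
    (gamma : 'cV[R]_n -> 'M[R[i]]_N) : 'M[R[i]]_N -> Prop :=
  generated (fun x => exists v, x = gamma v).

(* The action of v + s e_+ + t e_- in W on S = S(V) + S(V). *)
Definition gammaW (R : realType) (n N : nat)
    (gamma : 'cV[R]_n -> 'M[R[i]]_N) (v : 'cV[R]_n) (s t : R) :
    'M[R[i]]_(N + N) :=
  block_mx (- gamma v) ((s%:C * sqrt2 R)%:M)
           ((- (t%:C * sqrt2 R))%:M) (gamma v).

(* Elements of Cl(W), acting on S. *)
Definition in_ClW (R : realType) (n N : nat)
    (gamma : 'cV[R]_n -> 'M[R[i]]_N) : 'M[R[i]]_(N + N) -> Prop :=
  generated (fun x => exists v s t, x = gammaW gamma v s t).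

Definition commutator (C : fieldType) (m : nat) (x y : 'M[C]_m) : 'M[C]_m :=
  x *m y - y *m x.

Definition simple_clifford_map (R : realType) (n N : nat) (B : 'M[R]_n)
    (gamma : 'cV[R]_n -> 'M[R[i]]_N)
    (rho : cw_algebra R n -> 'M[R[i]]_(N + N)) : Prop :=
  [/\ real_linear rho,
      forall x, in_ClW gamma (rho x),
      forall v, rho (star v) =
        (sqrt2 R)^-1 *: block_mx 0 (gamma (B *m v)) 0 0
    & forall v x,
        rho (cw_bracket B (star v) x) = commutator (rho (star v)) (rho x)].

Definition simple_clifford_rep (R : realType) (n N : nat) (B : 'M[R]_n)
    (gamma : 'cV[R]_n -> 'M[R[i]]_N)
    (rho : cw_algebra R n -> 'M[R[i]]_(N + N)) : Prop :=
  simple_clifford_map B gamma rho /\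
  forall x y, rho (cw_bracket B x y) = commutator (rho x) (rho y).

Definition Gamma_star (R : realType) (n N : nat)
    (gamma : 'cV[R]_n -> 'M[R[i]]_N) : 'M[R[i]]_N :=
  ('i : R[i]) ^+ (n.+1)./2 *:
    \big[mulmx/1%:M]_(j < n) gamma (delta_mx j 0).

(* Pi^+ for true, Pi^- for false. *)
Definition Pi (R : realType) (n N : nat) (gamma : 'cV[R]_n -> 'M[R[i]]_N)
    (eps : bool) : 'M[R[i]]_N :=
  2^-1 *: (1%:M + (-1) ^+ (~~ eps) *: Gamma_star gamma).

(* c', d', e_1, e_2, e_3 are Clifford elements of the prescribed block types;
   upper signs are eps = true, lower signs eps = false. *)
Definition block_types (R : realType) (n N : nat)
    (gamma : 'cV[R]_n -> 'M[R[i]]_N) (eps : bool)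
    (c' d' e1 e2 e3 : 'M[R[i]]_N) : Prop :=
  let P := Pi gamma eps in
  let Q := Pi gamma (~~ eps) in
  [/\ in_ClV gamma c' /\ c' = P *m c' *m Q,
      in_ClV gamma d' /\ d' = Q *m d' *m P,
      in_ClV gamma e1 /\ e1 = P *m e1 *m Q,
      in_ClV gamma e2 /\ e2 = Q *m e2 *m P
    & in_ClV gamma e3 /\ e3 = P *m e3 *m P].

(* The family with scalar parameters alpha, beta, rho0.  sigma is a chosen
   square root of alpha beta + lambda; both choices occur, with
   sqrt (2 (alpha beta + lambda)) read as sqrt 2 * sigma.
   The sign of c' and d' in rho (e_-) is the one that the brackets
   [v^*, e_-] = B v force once rho (v) and the relation are written with
   c' v - v d'. *)
Definition scalar_family (R : realType) (n N : nat)
    (gamma : 'cV[R]_n -> 'M[R[i]]_N) (lambda : R) (eps : bool)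
    (alpha beta rho0 sigma : R[i]) (c' d' e1 e2 e3 : 'M[R[i]]_N)
    (rho : cw_algebra R n -> 'M[R[i]]_(N + N)) : Prop :=
  let P := Pi gamma eps in
  let Q := Pi gamma (~~ eps) in
  let s2 := sqrt2 R in
  [/\ real_linear rho /\ block_types gamma eps c' d' e1 e2 e3,
      alpha != 0 /\ sigma ^+ 2 = alpha * beta + lambda%:C,
      forall v, s2 * alpha *: (e1 *m gamma v + gamma v *m e2)
              = sigma *: (c' *m gamma v - gamma v *m d'),
      (forall v, rho (star v) =
         - (s2 * lambda%:C) *: block_mx 0 (gamma v) 0 0) /\
      rho (eplus R n) = s2 * alpha *: block_mx 0 P 0 0
    & rho (eminus R n) =
        rho0%:M
        + block_mx (- (s2 * sigma) *: Q - c')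
                   (s2 *: (beta *: Q + e1 + e2 + e3))
                   (- (s2 * alpha) *: Q)
                   (s2 * sigma *: Q - d') /\
      forall v, rho (vec v) =
        block_mx (- alpha *: (P *m gamma v))
                 (sigma *: gamma v + s2^-1 *: (c' *m gamma v - gamma v *m d'))
                 0
                 (alpha *: (Q *m gamma v))].

(* The same family with beta and the square root of alpha beta + lambda taken
   in the corner Pi^-+ Cl(V) Pi^-+, whose unit is Pi^-+; scalar_family is the
   case beta := beta Pi^-+, sigma := sigma Pi^-+.  The corner consists of
   scalars for n = 2 only. *)
Definition corner_family (R : realType) (n N : nat)
    (gamma : 'cV[R]_n -> 'M[R[i]]_N) (lambda : R) (eps : bool)
    (alpha rho0 : R[i]) (beta sigma c' d' e1 e2 e3 : 'M[R[i]]_N)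
    (rho : cw_algebra R n -> 'M[R[i]]_(N + N)) : Prop :=
  let P := Pi gamma eps in
  let Q := Pi gamma (~~ eps) in
  let s2 := sqrt2 R in
  [/\ real_linear rho /\ block_types gamma eps c' d' e1 e2 e3,
      [/\ alpha != 0,
          in_ClV gamma beta /\ beta = Q *m beta *m Q,
          in_ClV gamma sigma /\ sigma = Q *m sigma *m Q
        & sigma *m sigma = alpha *: beta + lambda%:C *: Q],
      forall v, s2 * alpha *: (e1 *m gamma v + gamma v *m e2)
              = c' *m sigma *m gamma v - gamma v *m sigma *m d',
      (forall v, rho (star v) =
         - (s2 * lambda%:C) *: block_mx 0 (gamma v) 0 0) /\
      rho (eplus R n) = s2 * alpha *: block_mx 0 P 0 0
    & rho (eminus R n) =
        rho0%:M
        + block_mx (- s2 *: sigma - c')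
                   (s2 *: (beta + e1 + e2 + e3))
                   (- (s2 * alpha) *: Q)
                   (s2 *: sigma - d') /\
      forall v, rho (vec v) =
        block_mx (- alpha *: (P *m gamma v))
                 (sigma *m gamma v + gamma v *m sigma
                  + s2^-1 *: (c' *m gamma v - gamma v *m d'))
                 0
                 (alpha *: (Q *m gamma v))].

(* The chiral diagonal blocks of the upper left entry of X are scalar. *)
Definition scalar_chiral_blocks (R : realType) (n N : nat)
    (gamma : 'cV[R]_n -> 'M[R[i]]_N) (X : 'M[R[i]]_(N + N)) : Prop :=
  forall eps : bool, exists mu : R[i],
    Pi gamma eps *m ulsubmx X *m Pi gamma eps = mu *: Pi gamma eps.

(* Main.v *)
Require Import Defs.
From HB Require Import structures.
From mathcomp Require Import all_boot all_order all_algebra.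
From mathcomp Require Import reals ring.
From mathcomp.real_closed Require Import complex.

Set Implicit Arguments.
Unset Strict Implicit.
Unset Printing Implicit Defensive.

Import Order.TTheory GRing.Theory Num.Theory.

Local Open Scope ring_scope.
Local Open Scope complex_scope.

(* Write rho (e_-) as a 2 x 2 matrix with lower left entry C.  The equivariance
   under V^* makes rho (e_+) strictly upper triangular, with entry b such that
   v C v = |v|^2 b, hence C v = - v b and v C = - b v for all v.  So C - b is
   central and C + b anticommutes with V: for odd n the volume element forces
   C + b = 0, while for even n both are scalar up to the volume element, and
   b C = 0 (from [e_+, e_-] = 0) makes C and b multiples of complementary chiral
   projectors Q and P.  Since every v exchanges P and Q, the bracket [e_-, v] = v^*
   splits into chiral corners: the diagonal ones fix rho (e_-) up to the stated
   parameters, and the Q-P corner reads (B v) P = 2 (alpha beta - sigma^2) v with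
   alpha beta - sigma^2 in the corner Q Cl(V) Q, so that B is scalar. *)

(** * Clifford generators and chiral projectors *)

(** Invertibility of B makes every vector of the form Bv, so equivariance under V^* expresses rho on
    V, and then rho (e_+), through the four entries of rho (e_-); the other brackets become
    equations for these entries. Irreducibility enters only through Schur's lemma, and in the corner
    computations a vector is just an element that exchanges P and Q. The obstacle is the Q-Q corner.
    The diagonal equations make both P-P blocks of rho (e_-) equal to rho0 P but control only the
    sum of the two Q-Q blocks. Their difference is an element sigma of Q Cl(V) Q, tied to beta by
    sigma^2 = alpha beta + lambda Q alone, and every such pair occurs. Hence two classifications:
    one with parameters in the corner, and one with scalars under [scalar_chiral_blocks], a
    condition on exactly the blocks that carry sigma. Both directions rest on [rot_ur_vec]: read
    corner by corner it yields the constraints, and with the constraints inserted it gives back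
    [e_-, v] = v^*. *)

Lemma eucl_delta_l (R : realType) n (i : 'I_n) (v : 'cV[R]_n) :
  eucl (delta_mx i 0) v = v i 0.
Proof.
rewrite /eucl (bigD1 i) //= big1 => [|j /negPf ji]; rewrite !mxE ?ji ?mul0r //.
by rewrite !eqxx mul1r addr0.
Qed.

Lemma euclC (R : realType) n (v w : 'cV[R]_n) : eucl v w = eucl w v.
Proof. by apply: eq_bigr => i _; rewrite mulrC. Qed.

Lemma eucl_eq0 (R : realType) n (v : 'cV[R]_n) : eucl v v = 0 -> v = 0.
Proof.
move/eqP; rewrite psumr_eq0 => [/allP v0|i _]; last by rewrite -expr2 sqr_ge0.
apply/colP=> i; rewrite mxE; apply/eqP.
by have := v0 i (mem_index_enum _); rewrite /= mulf_eq0 orbb.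
Qed.

Lemma eq_neg_self0 (K : numFieldType) (V : lmodType K) (x : V) :
  x = - x -> x = 0.
Proof.
move=> xN; apply: (scalerI (a := 2%:R)); first by rewrite pnatr_eq0.
by rewrite scaler0 scaler_nat mulr2n {2}xN subrr.
Qed.

Lemma scale_halfD (K : numFieldType) (V : lmodType K) (x : V) :
  2^-1 *: (x + x) = x.
Proof. by rewrite -mulr2n -[x *+ 2]scaler_nat scalerA mulVf ?pnatr_eq0 // scale1r. Qed.

Section CliffordAlgebra.

Variables (R : realType) (n : nat) (A : algType R[i]) (g : 'cV[R]_n -> A).
Hypothesis g_lin : forall a v w, g (a *: v + w) = a%:C *: g v + g w.
Hypothesis g_cliff :
  forall v w, g v * g w + g w * g v = ((- 2 * eucl v w)%:C)%:A.

Lemma cliff0 : g 0 = 0.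
Proof. by have := g_lin (-1) 0 0; rewrite scaler0 addr0 rmorphN1 scaleN1r addNr. Qed.

Lemma cliff_sum (v : 'cV[R]_n) :
  g v = \sum_(i < n) (v i 0)%:C *: g (delta_mx i 0).
Proof.
have gS (r : seq 'I_n) : g (\sum_(i <- r) v i 0 *: delta_mx i 0)
    = \sum_(i <- r) (v i 0)%:C *: g (delta_mx i 0).
  elim: r => [|i r IH]; first by rewrite !big_nil cliff0.
  by rewrite !big_cons g_lin IH.
rewrite -gS {1}[v]matrix_sum_delta; congr g.
by apply: eq_bigr => i _; rewrite big_ord1.
Qed.

Lemma cliff_sqr v : g v * g v = (- (eucl v v)%:C)%:A.
Proof.
have := g_cliff v v; rewrite -mulr2n -scaler_nat.
move/(congr1 (fun x => 2^-1 *: x)); rewrite scalerA mulVf ?pnatr_eq0 // scale1r => ->.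
rewrite scalerA mulNr rmorphN rmorphM /= mulrN; congr ((- _) *: _).
by rewrite mulrA rmorph_nat mulVf ?pnatr_eq0 // mul1r.
Qed.

Lemma cliff_delta_sqr i : g (delta_mx i 0) * g (delta_mx i 0) = -1.
Proof.
by rewrite cliff_sqr eucl_delta_l mxE !eqxx scaleN1r.
Qed.

Lemma cliff_delta_anti i j : i != j ->
  g (delta_mx i 0) * g (delta_mx j 0) = - (g (delta_mx j 0) * g (delta_mx i 0)).
Proof.
move=> ij; apply/eqP; rewrite -addr_eq0 g_cliff eucl_delta_l mxE (negPf ij).
by rewrite mulr0 scale0r.
Qed.

Lemma cliff_basis_comm (x : A) (k : R[i]) :
  (forall i, g (delta_mx i 0) * x = k *: (x * g (delta_mx i 0))) ->
  forall v, g v * x = k *: (x * g v).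
Proof.
move=> gx v; rewrite cliff_sum mulr_suml mulr_sumr scaler_sumr.
by apply: eq_bigr => i _; rewrite -scalerAl gx -scalerAr !scalerA mulrC.
Qed.

(** Each factor other than [g_i] itself costs a sign. The exponent adds the indicator of [i \in r]
    where a count would subtract it; the parity is the same and no truncated subtraction arises. *)
Lemma mul_cliff_prod (r : seq 'I_n) (i : 'I_n) : uniq r ->
  g (delta_mx i 0) * \prod_(j <- r) g (delta_mx j 0)
  = (-1) ^+ (size r + (i \in r))
    *: (\prod_(j <- r) g (delta_mx j 0) * g (delta_mx i 0)).
Proof.
elim: r => [_|j r IH /= /andP[jr /IH {}IH]].
  by rewrite !big_nil mulr1 !mul1r scale1r.
rewrite !big_cons inE addSn.
have [ij|ij] := eqVneq i j.
  rewrite -ij in jr *; move: IH; rewrite (negPf jr) addn0 addn1.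
  set e := g _; set p := \prod_(_ <- _) _ => ep.
  have {}ep : p * e = (-1) ^+ size r *: (e * p).
    by rewrite ep scalerA -expr2 sqrr_sign scale1r.
  rewrite -(mulrA e p e) ep -scalerAr scalerA -exprD !addSn addnn -mul2n.
  by rewrite !exprS exprM sqrrN !expr1n mulr1 mulrNN mulr1 scale1r.
rewrite mulrA cliff_delta_anti // mulNr -(mulrA _ (g (delta_mx i 0))) IH -scalerAr mulrA.
by rewrite orFb exprS mulN1r scaleNr.
Qed.

(** For k anticommuting factors of square -1 the sign is (-1)^(k(k+1)/2), and k(k+1)/2 has the
    parity of floor((k+1)/2). The power of i in [chirality] removes this sign. *)
Lemma cliff_prod_sqr (r : seq 'I_n) : uniq r ->
  (\prod_(j <- r) g (delta_mx j 0)) * (\prod_(j <- r) g (delta_mx j 0))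
  = ((-1) ^+ ((size r).+1)./2)%:A.
Proof.
elim: r => [_|j r IH /= /andP[jr ur]].
  by rewrite !big_nil mulr1 scale1r.
rewrite !big_cons; have := mul_cliff_prod j ur; rewrite (negPf jr) addn0.
set p := \prod_(_ <- _) _ in IH *; set e := g _ => ep.
have {}ep : p * e = (-1) ^+ size r *: (e * p).
  by rewrite ep scalerA -expr2 sqrr_sign scale1r.
rewrite mulrA -[e * p * e]mulrA ep -scalerAr -scalerAl mulrA cliff_delta_sqr.
rewrite mulN1r mulNr (IH ur) scalerN -scaleNr scalerA; congr (_ *: _).
(* With k = [size r], it remains that k + ceil(k/2) and floor(k/2) have the same parity, which holds
   as ceil(k/2) - floor(k/2) is the parity of k. *)
rewrite [RHS]exprS mulN1r mulNr -exprD; congr (- _); rewrite -[LHS]signr_odd -[RHS]signr_odd.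
by rewrite oddD -uphalfE uphalf_half oddD oddb addbA addbb.
Qed.

Lemma anti_cliff_prod (x : A) (r : seq 'I_n) :
  (forall v, g v * x = - (x * g v)) ->
  (\prod_(j <- r) g (delta_mx j 0)) * x
  = (-1) ^+ size r *: (x * \prod_(j <- r) g (delta_mx j 0)).
Proof.
move=> gx; elim: r => [|j r IH]; first by rewrite big_nil mulr1 mul1r scale1r.
rewrite !big_cons -mulrA IH -scalerAr (mulrA _ x) gx mulNr scalerN exprS mulN1r.
by rewrite scaleNr mulrA.
Qed.

(** Written with the ring product of [A]; for matrices it is convertible to [Gamma_star]. *)
Definition chirality : A :=
  ('i : R[i]) ^+ (n.+1)./2 *: \prod_(j < n) g (delta_mx j 0).

Lemma chirality_sqr : chirality * chirality = 1.
Proof.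
rewrite /chirality -scalerAl -scalerAr cliff_prod_sqr ?index_enum_uniq //.
rewrite /index_enum -enumT size_enum_ord !scalerA -!exprMn -expr2 sqr_i mulrNN.
by rewrite mulr1 expr1n scale1r.
Qed.

(** Of the n factors exactly n - 1 anticommute with a given basis vector. So the volume element is
    central for odd n and anticommutes with V for even n. *)
Lemma cliff_chirality v : g v * chirality = (-1) ^+ n.+1 *: (chirality * g v).
Proof.
apply: cliff_basis_comm => i.
rewrite /chirality -scalerAr mul_cliff_prod ?index_enum_uniq // mem_index_enum.
by rewrite /index_enum -enumT size_enum_ord addn1 -scalerAl !scalerA mulrC.
Qed.

Lemma chirality_anti (x : A) : (forall v, g v * x = - (x * g v)) ->
  chirality * x = (-1) ^+ n *: (x * chirality).
Proof.
move=> /anti_cliff_prod gx; rewrite /chirality -scalerAl gx.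
by rewrite -scalerAr /index_enum -enumT size_enum_ord !scalerA mulrC.
Qed.

Definition chiral_proj (eps : bool) : A :=
  2^-1 *: (1 + (-1) ^+ (~~ eps) *: chirality).

Lemma chiral_projD eps : chiral_proj eps + chiral_proj (~~ eps) = 1.
Proof.
rewrite /chiral_proj -scalerDr addrACA -scalerDl.
have -> : (-1) ^+ (~~ eps) + (-1) ^+ (~~ ~~ eps) = 0 :> R[i].
  by case: eps => /=; rewrite expr1 expr0 ?subrr ?addNr.
by rewrite scale0r addr0 scale_halfD.
Qed.

Lemma chiral_projM eps : chiral_proj eps * chiral_proj (~~ eps) = 0.
Proof.
rewrite /chiral_proj -scalerAl -scalerAr.
suff -> : (1 + (-1) ^+ (~~ eps) *: chirality)
          * (1 + (-1) ^+ (~~ ~~ eps) *: chirality) = 0 by rewrite !scaler0.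
case: eps => /=; rewrite expr1 expr0 scaleN1r scale1r;
  rewrite ?(mulrDl, mulrDr) ?(mulrN, mulNr) !(mul1r, mulr1) chirality_sqr.
  by rewrite addrA subrK subrr.
by rewrite addrA addrK subrr.
Qed.

Lemma chiral_projMC eps : chiral_proj (~~ eps) * chiral_proj eps = 0.
Proof. by rewrite -{2}[eps]negbK chiral_projM. Qed.

Lemma chiral_proj_idem eps : chiral_proj eps * chiral_proj eps = chiral_proj eps.
Proof.
by rewrite -[RHS]mulr1 -(chiral_projD eps) mulrDr chiral_projM addr0.
Qed.

Lemma cliff_chiral_proj eps v : ~~ odd n ->
  g v * chiral_proj eps = chiral_proj (~~ eps) * g v.
Proof.
move=> n_even; rewrite /chiral_proj -scalerAr -scalerAl; congr (_ *: _).
rewrite mulrDr mulrDl mulr1 mul1r -scalerAr -scalerAl cliff_chirality.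
rewrite scalerA -(signr_odd _ n.+1) /= n_even; congr (_ + _ *: _).
by case: eps; rewrite /= !(expr0, expr1, mulrN1, mulN1r, opprK, mulr1, mul1r).
Qed.

(** If P were 0, then Q = 1 and a unit vector would satisfy e = e Q = P e = 0, against e^2 = -1. *)
Lemma chiral_proj_neq0 eps : (0 < n)%N -> ~~ odd n -> chiral_proj eps != 0.
Proof.
move=> n_gt0 n_even; apply/eqP => P0; pose e := g (delta_mx (Ordinal n_gt0) 0).
have e0 : e = 0.
  rewrite -[e]mulr1 -(chiral_projD eps) P0 add0r cliff_chiral_proj // negbK P0.
  by rewrite mul0r.
have := cliff_delta_sqr (Ordinal n_gt0); rewrite -/e e0 mul0r => /eqP.
by rewrite eq_sym oppr_eq0 oner_eq0.
Qed.

(** The hypotheses are the two off-diagonal corners of Bv = 2 (T v + v T). For the unit vector e =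
    [delta_mx i0 0] both (Be) e Q and e (Be) Q equal -2 T, while the Clifford relation makes their
    sum -2 m Q with m = <Be, e>; so T = (m/2) Q. Then (Bv - m v) P = 0 for all v. *)
Lemma chiral_symbol_scalar (B : 'M[R]_n) (T : A) eps : (0 < n)%N -> ~~ odd n ->
    (forall v, g (B *m v) * chiral_proj eps = 2 *: (T * g v)) ->
    (forall v, g (B *m v) * chiral_proj (~~ eps) = 2 *: (g v * T)) ->
  exists lambda, B = (- 2 * lambda)%:M /\ T = - lambda%:C *: chiral_proj (~~ eps).
Proof.
move=> n_gt0 n_even BP BQ; pose i0 := Ordinal n_gt0; set P := chiral_proj eps in BP.
set Q := chiral_proj _ in BQ *; pose e := g (delta_mx i0 0); pose m := B i0 i0.
have two0 : 2 != 0 :> R[i] by rewrite pnatr_eq0.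
have eQ v : g v * Q = P * g v by rewrite cliff_chiral_proj // negbK.
have TQ : T = (2^-1 * m%:C) *: Q.
  have e2 : e * e = -1 by rewrite cliff_delta_sqr.
  have BeQ : g (B *m delta_mx i0 0) * e * Q = 2 *: - T.
    by rewrite -mulrA eQ mulrA BP -scalerAl -mulrA e2 mulrN1.
  have eBQ : e * g (B *m delta_mx i0 0) * Q = 2 *: - T.
    by rewrite -mulrA BQ -scalerAr mulrA e2 mulN1r.
  have := congr1 (fun x => x * Q) (g_cliff (B *m delta_mx i0 0) (delta_mx i0 0)).
  rewrite /= mulrDl BeQ eBQ -scalerDr -scalerAl mul1r euclC eucl_delta_l.
  rewrite -colE mxE -/m mulNr rmorphN rmorphM /= rmorph_nat scaleNr -opprD scalerN.
  move/oppr_inj => TT; rewrite -scalerA in TT; have {}TT := scalerI two0 TT.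
  by rewrite -scalerA -TT scale_halfD.
have Bm (v : 'cV[R]_n) : B *m v = m *: v.
  apply: subr0_eq; apply: eucl_eq0; set w := _ - _.
  have wP : g w * P = 0.
    rewrite /w addrC -scaleNr g_lin mulrDl BP TQ -scalerAl.
    rewrite -(scalerAl _ Q) scalerA (mulrA 2) mulfV //.
    by rewrite mul1r /Q /P cliff_chiral_proj // rmorphN scaleNr addNr.
  (* A nonzero vector is invertible, since w^2 = -|w|^2, so w P = 0 with P nonzero forces w = 0. *)
  have := congr1 (fun x => g w * x) wP; rewrite /= mulrA cliff_sqr mulr0 -scalerAl mul1r.
  move/eqP; rewrite scaler_eq0 oppr_eq0 fmorph_eq0 (negPf (chiral_proj_neq0 _ _ _)) //.
  by rewrite orbF => /eqP.
exists (- (2^-1 * m)); split.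
  rewrite mulrNN mulrA mulfV ?pnatr_eq0 // mul1r; apply/matrixP => i j.
  have := congr1 (fun x : 'cV_n => x i 0) (Bm (delta_mx j 0)).
  by rewrite -colE !mxE eqxx andbT mulr_natr.
by rewrite TQ rmorphN opprK rmorphM /= fmorphV rmorph_nat.
Qed.

Hypothesis schur :
  forall x : A, (forall v, x * g v = g v * x) -> exists k : R[i], x = k%:A.

(* [C - b] is central and [C + b] anticommutes with [V], so both are determined
   up to a scalar; then [b C = 0] makes [C] a multiple of a chiral projector. *)
Lemma sandwich_chiral (b C : A) :
    (forall v, g v * C * g v = (eucl v v)%:C *: b) -> b * C = 0 -> b != 0 ->
  ~~ odd n /\ exists eps k,
    [/\ k != 0, b = k *: chiral_proj eps & C = - k *: chiral_proj (~~ eps)].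
Proof.
move=> gCg bC b0.
have Cg v : C * g v = - (g v * b) /\ g v * C = - (b * g v).
  have [v0|v0] := eqVneq (eucl v v) 0.
    by rewrite (eucl_eq0 v0) cliff0 !mul0r !mulr0 oppr0.
  have k0 : - (eucl v v)%:C != 0 by rewrite oppr_eq0 fmorph_eq0.
  split; apply: (scalerI k0).
    rewrite -[LHS]mul1r -scalerAr scalerAl -cliff_sqr -!mulrA (mulrA _ C) gCg.
    by rewrite -scalerAr scaleNr scalerN opprK.
  rewrite -[LHS]mulr1 -scalerAl scalerAr -cliff_sqr !mulrA gCg.
  by rewrite -scalerAl scaleNr scalerN opprK.
have gC v : g v * (C + b) = - ((C + b) * g v).
  have [Cg1 gC1] := Cg v.
  by rewrite mulrDr mulrDl gC1 Cg1 opprD opprK addrC.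
have [p Cp] : exists p, C - b = p%:A.
  apply: schur => v; have [Cg1 gC1] := Cg v.
  by rewrite mulrBr mulrBl gC1 Cg1 addrC.
have two0 : 2 != 0 :> R[i] by rewrite pnatr_eq0.
have Cb2 : C = 2^-1 *: ((C + b) + (C - b)) /\ b = 2^-1 *: ((C + b) - (C - b)).
  have CbC : (C + b) + (C - b) = C + C by rewrite addrACA subrr addr0.
  have Cbb : (C + b) - (C - b) = b + b by rewrite opprB addrC addrA subrK.
  by rewrite CbC Cbb !scale_halfD.
have [n_odd|n_even] := boolP (odd n).
  exfalso.
  have [m chim] : exists m, chirality = m%:A.
    apply: schur => v; rewrite cliff_chirality -(signr_odd _ n.+1) /= n_odd.
    by rewrite expr0 scale1r.
  have m0 : m != 0.
    apply/eqP => m0; have := chirality_sqr; rewrite chim m0 scale0r mul0r.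
    by move/esym/eqP; rewrite oner_eq0.
  (* For odd n, [C + b] picks up an odd number of signs in passing [chirality], which is here a
     nonzero scalar. *)
  have {gC} Cb0 : C + b = 0.
    apply: (scalerI m0); rewrite scaler0; apply: eq_neg_self0.
    have := chirality_anti gC; rewrite -signr_odd n_odd expr1 scaleN1r chim.
    by rewrite -scalerAl -scalerAr mul1r mulr1.
  (* Now b = -C is the scalar -p/2, and b C = -b^2 = 0 makes it vanish, against [b0]. *)
  have [_ b2] := Cb2; move: b2 bC; rewrite Cb0 sub0r Cp -scaleNr scalerA.
  have -> : C = - b by apply/eqP; rewrite -addr_eq0 Cb0.
  set t := 2^-1 * _ => b2; rewrite mulrN {1}b2 -scalerAl mul1r b2 scalerA -scaleNr.
  move/eqP; rewrite scaler_eq0 oner_eq0 orbF oppr_eq0 mulf_eq0 orbb => /eqP t0.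
  by rewrite b2 t0 scale0r eqxx in b0.
split=> //.
(* For even n both [C + b] and [chirality] anticommute with V, so their product is central;
   [chirality] is its own inverse. *)
have [q Cq] : exists q, (C + b) * chirality = q%:A.
  apply: schur => v; rewrite (mulrA (g v)) gC mulNr -!mulrA cliff_chirality.
  rewrite -(signr_odd _ n.+1) /= n_even expr1 scaleN1r mulrN opprK //.
have {}Cq : C + b = q *: chirality.
  by rewrite -[LHS]mulr1 -chirality_sqr mulrA Cq -scalerAl mul1r.
case: Cb2; rewrite Cq Cp => C2 b2.
(* With chi for [chirality], b C = 0 reads (q chi - p)(q chi + p) = q^2 - p^2 = 0. *)
have qp : (q - p) * (q + p) == 0.
  have : (q *: chirality - p%:A) * (q *: chirality + p%:A) = 0.
    move/(congr1 (fun x => 2 *: (2 *: x))): bC; rewrite C2 b2 -scalerAl -scalerAr.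
    by rewrite !scaler0 !scalerA; rewrite mulfK // mulfV // scale1r.
  move: chirality chirality_sqr => x x2.
  rewrite mulrDr !mulrDl !(mulNr, mulrN) -!scalerAl -!scalerAr.
  rewrite !mul1r !mulr1 x2 !scalerA (mulrC p q).
  rewrite addrA subrK -scalerBl => /eqP.
  by rewrite scaler_eq0 oner_eq0 orbF -!expr2 subr_sqr -mulrBl.
have hk e : chiral_proj e = 2^-1 *: (1 + (-1) ^+ (~~ e) *: chirality) by [].
(* As b = (q chi - p)/2, the case q = -p gives b = -p (1 + chi)/2 and the case q = p gives b = -p (1
   - chi)/2. *)
exists (q == - p), (- p).
have p0 : p != 0.
  apply/eqP => p0; move: qp b0; rewrite p0 subr0 addr0 mulf_eq0 orbb => /eqP q0.
  by rewrite b2 p0 q0 !scale0r subr0 scaler0 eqxx.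
rewrite oppr_eq0 b2 C2 !hk !scalerA !(mulrC _ 2^-1) -!scalerA; move: chirality => x.
have [-> | qNp] := eqVneq q (- p).
  split=> //; congr (_ *: _); rewrite /= ?expr0 ?expr1 ?scale1r ?scaleN1r.
    by rewrite scalerDr addrC -scaleNr.
  by rewrite opprK scalerBr scaleNr addrC.
have -> : q = p.
  move: qp; rewrite mulf_eq0 => /orP[/eqP/subr0_eq //|].
  by rewrite addr_eq0 => /eqP qE; rewrite qE eqxx in qNp.
split=> //; congr (_ *: _); rewrite /= ?expr0 ?expr1 ?scale1r ?scaleN1r.
  by rewrite scalerBr !scaleNr opprK addrC.
by rewrite opprK scalerDr addrC.
Qed.

End CliffordAlgebra.

(** * Calculus in the corners of a pair of complementary idempotents *)

Lemma idem_scale_corner (K : fieldType) (A : algType K) (X : A) (k : K) :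
  X * X = X -> k *: X = X * (k *: X) * X.
Proof. by move=> XX; rewrite -scalerAr -scalerAl !XX. Qed.

Lemma idem_scale_mul (K : fieldType) (A : algType K) (X : A) (k l : K) :
  X * X = X -> (k *: X) * (l *: X) = (k * l) *: X.
Proof. by move=> XX; rewrite -scalerAl -scalerAr XX scalerA. Qed.

Section Corners.

Variables (K : fieldType) (A : algType K) (P Q : A).
Hypotheses (PDQ : P + Q = 1) (PQ : P * Q = 0) (QP : Q * P = 0).

Lemma corner_idem : P * P = P /\ Q * Q = Q.
Proof.
by split; rewrite -[RHS]mulr1 -PDQ mulrDr ?PQ ?QP ?addr0 ?add0r.
Qed.

Lemma corner_absorb (X Y x : A) : X * X = X -> Y * Y = Y -> x = X * x * Y ->
  X * x = x /\ x * Y = x.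
Proof. by move=> XX YY ->; split; rewrite -?mulrA ?YY // !mulrA XX. Qed.

Lemma mul_corner0 (X Y x y : A) : X * Y = 0 -> x * X = x -> Y * y = y -> x * y = 0.
Proof. by move=> XY <- <-; rewrite -mulrA (mulrA X) XY mul0r mulr0. Qed.

Lemma corner_decomp x : x = P * x * P + P * x * Q + (Q * x * P + Q * x * Q).
Proof. by rewrite -!mulrDr -!mulrDl PDQ mulr1 mul1r. Qed.

Definition chirality_odd (u : A) := u * P = Q * u /\ u * Q = P * u.

(** After cancelling k, the P-Q corner of the first bracket equation reads 2 PaP v = v (QaQ + QdQ),
    and the Q-P corner of the second reads 2 v PaP = (QaQ + QdQ) v. So 2 PaP + QaQ + QdQ commutes
    with V and is a scalar l by Schur; rho0 is l/2. Only the sum of QaQ and QdQ is determined, so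
    QdQ survives as a free corner element, the later [sigma]. *)
Lemma rot_diagonal_blocks (V : Type) (g : V -> A) (k : K) (a d : A) :
    (forall x, (forall v, x * g v = g v * x) -> exists l : K, x = l%:A) ->
    (forall v, chirality_odd (g v)) -> k != 0 -> (2 : K) != 0 -> P * d = a * P ->
    (forall v, a * (g v * (k *: Q))
      - (g v * (k *: Q) * a + (g v * d - a * g v) * (k *: Q)) = 0) ->
    (forall v, k *: Q * (g v * d - a * g v) - d * (k *: Q * g v)
      + k *: Q * g v * d = 0) ->
  exists rho0 : K,
    a = rho0%:A + (rho0 *: Q - Q * d * Q + P * a * Q) /\
    d = rho0%:A + (Q * d * Q - rho0 *: Q + Q * d * P).
Proof.
move=> schur g_odd k0 two0 Pd_aP eq11 eq22.
have [PP QQ] := corner_idem.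
have eqPQ v : 2 *: (P * a * P * g v) = g v * (Q * a * Q + Q * d * Q).
  have [uP uQ] := g_odd v; move: (g v) uP uQ (eq11 v) => u uP uQ.
  rewrite -!scalerAr -scalerAl -scalerDr -scalerBr => /eqP.
  rewrite scaler_eq0 (negPf k0) => /eqP/(congr1 (fun x => P * x * Q)).
  rewrite !(mulrBl, mulrBr, mulrDl, mulrDr, mulr0, mul0r).
  have -> : P * (a * (u * Q)) * Q = P * a * P * u by rewrite -!mulrA QQ uQ.
  have -> : P * (a * u * Q) * Q = P * a * P * u by rewrite -!mulrA QQ uQ.
  have -> : P * (u * Q * a) * Q = u * (Q * a * Q) by rewrite !mulrA -uQ -(mulrA u) QQ.
  have -> : P * (u * d * Q) * Q = u * (Q * d * Q) by rewrite -!mulrA QQ !mulrA uQ.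
  move/subr0_eq => XYZ; rewrite -mulrDr scaler_nat mulr2n {1}XYZ -addrA subrK.
  by rewrite mulrDr.
have PdP : P * d * P = P * a * P.
  by rewrite Pd_aP -(mulrA a) PP -(mulrA P) -Pd_aP mulrA PP.
have eqQP v : 2 *: (g v * (P * a * P)) = (Q * a * Q + Q * d * Q) * g v.
  have [uP uQ] := g_odd v; move: (g v) uP uQ (eq22 v) => u uP uQ.
  rewrite -!scalerAl -!scalerAr -scalerBr -scalerDr => /eqP.
  rewrite scaler_eq0 (negPf k0) => /eqP/(congr1 (fun x => Q * x * P)).
  rewrite !(mulrBl, mulrBr, mulrDl, mulrDr, mulr0, mul0r).
  have -> : Q * (Q * (u * d)) * P = u * (P * d * P) by rewrite !mulrA QQ -uP.
  have -> : Q * (Q * (a * u)) * P = Q * a * Q * u by rewrite -!mulrA uP !mulrA QQ.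
  have -> : Q * (d * (Q * u)) * P = Q * d * Q * u.
    by rewrite -!mulrA uP (mulrA Q Q u) QQ.
  have -> : Q * (Q * u * d) * P = u * (P * d * P) by rewrite !mulrA QQ -uP.
  rewrite PdP => XYZ.
  apply/eqP; rewrite -subr_eq0 -XYZ scaler_nat mulr2n opprD !addrA.
  by rewrite [X in X == _](ACl (1*3*4*2)).
have [l lE] : exists l : K, 2 *: (P * a * P) + (Q * a * Q + Q * d * Q) = l%:A.
  apply: schur => v.
  by rewrite mulrDl mulrDr -scalerAl -scalerAr eqPQ eqQP addrC.
have PaP : P * a * P = (2^-1 * l) *: P.
  have := congr1 (fun x => P * x) lE.
  rewrite /= mulrDr -scalerAr mulrDr !mulrA PP PQ !mul0r !addr0 -scalerAr mulr1.
  by move/(congr1 (fun x => 2^-1 *: x)); rewrite !scalerA mulVf // scale1r.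
have QaQ : Q * a * Q + Q * d * Q = l *: Q.
  have := congr1 (fun x => Q * x) lE.
  rewrite /= mulrDr -scalerAr mulrDr !mulrA QQ QP !mul0r scaler0 add0r.
  by rewrite -scalerAr mulr1.
have QaP : Q * a * P = 0 by rewrite -mulrA -Pd_aP mulrA QP mul0r.
have PdQ : P * d * Q = 0 by rewrite Pd_aP -mulrA PQ mulr0.
have one_l : (2^-1 * l)%:A = (2^-1 * l) *: P + (2^-1 * l) *: Q.
  by rewrite -scalerDr PDQ.
have ll : l = 2^-1 * l + 2^-1 * l.
  rewrite -mulrDl -{1}[l]mul1r; congr (_ * _).
  by rewrite -[2^-1]mul1r -mulrDl -[1 + 1]/(2%:R) mulfV.
exists (2^-1 * l); split.
  rewrite {1}(corner_decomp a) PaP QaP add0r one_l.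
  rewrite -[Q * a * Q](addrK (Q * d * Q)) QaQ {2}ll scalerDl -!addrA; congr (_ + _).
  by rewrite addrC -!addrA.
rewrite {1}(corner_decomp d) PdP PaP PdQ addr0 one_l -!addrA; congr (_ + _).
by rewrite [RHS]addrCA addNKr addrC.
Qed.

(** * Entries of a member of the family and the bracket identities between them *)

Variables (s alpha : K) (sigma beta c d e1 e2 e3 : A).
Hypotheses (s2 : s * s = 2)
  (sigmaE : sigma = Q * sigma * Q) (betaE : beta = Q * beta * Q)
  (cE : c = P * c * Q) (dE : d = Q * d * P)
  (e1E : e1 = P * e1 * Q) (e2E : e2 = Q * e2 * P) (e3E : e3 = P * e3 * P).

(* The entries of rho (e_-) - rho0 and, in [vec_entry], sqrt 2 times the upper
   right entry of rho (u); [s] stands for sqrt 2.  The constraints of the family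
   are [corner_defect = - lambda Q] and [odd_defect = 0]. *)
Definition ul_entry := - (s *: sigma) - c.
Definition ur_entry := s *: (beta + e1 + e2 + e3).
Definition dl_entry := - (s * alpha) *: Q.
Definition dr_entry := s *: sigma - d.
Definition vec_entry u := u * dr_entry - ul_entry * u.
Definition corner_defect := alpha *: beta - sigma * sigma.
Definition odd_defect u :=
  s * alpha *: (e1 * u + u * e2) - (c * sigma * u - u * sigma * d).

Let PP := corner_idem.1.
Let QQ := corner_idem.2.
Let Qs := (corner_absorb QQ QQ sigmaE).1.
Let sQ := (corner_absorb QQ QQ sigmaE).2.
Let Qb := (corner_absorb QQ QQ betaE).1.
Let bQ := (corner_absorb QQ QQ betaE).2.
Let Pc := (corner_absorb PP QQ cE).1.
Let cQ := (corner_absorb PP QQ cE).2.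
Let Qd := (corner_absorb QQ PP dE).1.
Let dP := (corner_absorb QQ PP dE).2.
Let Pe1 := (corner_absorb PP QQ e1E).1.
Let e1Q := (corner_absorb PP QQ e1E).2.
Let Qe2 := (corner_absorb QQ PP e2E).1.
Let e2P := (corner_absorb QQ PP e2E).2.
Let Pe3 := (corner_absorb PP PP e3E).1.
Let e3P := (corner_absorb PP PP e3E).2.

Let Ps : P * sigma = 0. Proof. exact: mul_corner0 PQ PP Qs. Qed.
Let sP : sigma * P = 0. Proof. exact: mul_corner0 QP sQ PP. Qed.
Let Qc : Q * c = 0. Proof. exact: mul_corner0 QP QQ Pc. Qed.
Let cP : c * P = 0. Proof. exact: mul_corner0 QP cQ PP. Qed.
Let Pd : P * d = 0. Proof. exact: mul_corner0 PQ PP Qd. Qed.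
Let dQ : d * Q = 0. Proof. exact: mul_corner0 PQ dP QQ. Qed.

Lemma vec_entryE u :
  vec_entry u = s *: (sigma * u + u * sigma) + (c * u - u * d).
Proof.
rewrite /vec_entry /dr_entry /ul_entry mulrBr mulrBl mulNr opprB opprK.
rewrite -scalerAr -scalerAl scalerDr addrC addrA [RHS]addrA; congr (_ - _).
by rewrite -addrA addrC.
Qed.

(** No equation has constrained the upper right entry of rho (e_-) yet: its Peirce components,
    divided by t = sqrt 2, become beta, e1, e2, e3. *)
Lemma corner_ur_entry (t : K) (x : A) : t != 0 ->
  x = t *: (t^-1 *: (Q * x * Q) + t^-1 *: (P * x * Q) + t^-1 *: (Q * x * P)
            + t^-1 *: (P * x * P)).
Proof.
move=> t0; rewrite -!scalerDr scalerA mulfV // scale1r {1}(corner_decomp x) !addrA.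
by rewrite [LHS](ACl (4*2*3*1)).
Qed.

Section OneVector.

Variable u : A.
Hypothesis u_odd : chirality_odd u.

Let uP := u_odd.1.
Let uQ := u_odd.2.

(** As u flips chirality, x u y vanishes when x is supported on the right, and y on the left, by the
    same projector. Every use has X = Y = Q and X' = P. *)
Let odd0 X Y X' x y : u * Y = X' * u -> X * X' = 0 -> x * X = x -> Y * y = y ->
  x * u * y = 0.
Proof.
by move=> uY XX' <- <-; rewrite -!mulrA (mulrA u) uY !mulrA -(mulrA x) XX' mulr0 !mul0r.
Qed.

Let sus : sigma * u * sigma = 0. Proof. exact: odd0 uQ QP sQ Qs. Qed.
Let suQ : sigma * u * Q = 0. Proof. exact: odd0 uQ QP sQ QQ. Qed.
Let Qus : Q * u * sigma = 0. Proof. exact: odd0 uQ QP QQ Qs. Qed.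
Let cuQ : c * u * Q = 0. Proof. exact: odd0 uQ QP cQ QQ. Qed.
Let cus : c * u * sigma = 0. Proof. exact: odd0 uQ QP cQ Qs. Qed.
Let Qud : Q * u * d = 0. Proof. exact: odd0 uQ QP QQ Qd. Qed.
Let sud : sigma * u * d = 0. Proof. exact: odd0 uQ QP sQ Qd. Qed.
Let cud : c * u * d = 0. Proof. exact: odd0 uQ QP cQ Qd. Qed.
Let QuQ : Q * u * Q = 0. Proof. exact: odd0 uQ QP QQ QQ. Qed.
Let scr : sigma * c = 0. Proof. exact: mul_corner0 QP sQ Pc. Qed.
Let ds : d * sigma = 0. Proof. exact: mul_corner0 PQ dP Qs. Qed.
Let cc : c * c = 0. Proof. exact: mul_corner0 QP cQ Pc. Qed.
Let dd : d * d = 0. Proof. exact: mul_corner0 PQ dP Qd. Qed.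

Lemma proj_vec_entry : Q * vec_entry u = s *: (sigma * u).
Proof.
rewrite vec_entryE mulrDr -scalerAr mulrDr mulrBr !mulrA Qs Qus Qc Qud.
by rewrite mul0r subr0 !addr0.
Qed.

Lemma vec_entry_proj : vec_entry u * Q = s *: (u * sigma).
Proof.
rewrite vec_entryE mulrDl -scalerAl mulrDl mulrBl suQ cuQ -!mulrA sQ dQ.
by rewrite mulr0 subr0 addr0 add0r.
Qed.

Lemma corner_ul0 : ul_entry * (u * dl_entry) = 0.
Proof.
rewrite /dl_entry -!scalerAr mulrA /ul_entry mulrBl mulNr mulrBl mulNr.
by rewrite -!scalerAl suQ cuQ scaler0 oppr0 addr0 scaler0.
Qed.

Lemma corner_dr0 : dl_entry * u * dr_entry = 0.
Proof.
rewrite /dl_entry -!scalerAl /dr_entry mulrBr -scalerAr Qus Qud.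
by rewrite scaler0 subr0 scaler0.
Qed.

Lemma proj_ul : Q * ul_entry = - (s *: sigma).
Proof. by rewrite /ul_entry mulrBr mulrN -scalerAr Qs Qc subr0. Qed.

Lemma dr_proj : dr_entry * Q = s *: sigma.
Proof. by rewrite /dr_entry mulrBl -scalerAl sQ dQ subr0. Qed.

Lemma rot_ul_vec :
  ul_entry * (u * dl_entry) - (u * dl_entry * ul_entry + vec_entry u * dl_entry) = 0.
Proof.
rewrite corner_ul0 /dl_entry -!scalerAr -scalerAl -mulrA proj_ul vec_entry_proj.
by rewrite mulrN -scalerAr -scalerDr addNr scaler0 subr0.
Qed.

Lemma rot_dl_vec : dl_entry * (u * dl_entry) = 0.
Proof. by rewrite /dl_entry -!scalerAr -scalerAl mulrA QuQ !scaler0. Qed.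

Lemma rot_dr_vec :
  dl_entry * vec_entry u - dr_entry * (dl_entry * u) + dl_entry * u * dr_entry = 0.
Proof.
rewrite corner_dr0 addr0 /dl_entry -!scalerAl -scalerAr mulrA dr_proj proj_vec_entry.
by rewrite -scalerAl subrr.
Qed.

(** The products [ul_entry * u * dr_entry] vanish. The squares of [ul_entry] and [dr_entry] give
    sigma^2 and the products of sigma with c and d; next to Q only beta + e1 and beta + e2 survive
    of [ur_entry]. Thus e3 drops out, which is why it stays free. *)
Lemma rot_ur_vec :
  ul_entry * vec_entry u - ur_entry * (dl_entry * u)
    - (u * dl_entry * ur_entry + vec_entry u * dr_entry)
  = 2 *: (corner_defect * u + u * corner_defect) + s *: odd_defect u.
Proof.
have ul2 : ul_entry * ul_entry = 2 *: (sigma * sigma) + s *: (c * sigma).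
  rewrite /ul_entry -opprD mulrNN mulrDl !mulrDr -!scalerAl -!scalerAr scr cc.
  by rewrite scaler0 !addr0 scalerA s2.
have dr2 : dr_entry * dr_entry = 2 *: (sigma * sigma) - s *: (sigma * d).
  rewrite /dr_entry mulrBl !mulrBr -!scalerAl -!scalerAr ds dd.
  by rewrite scaler0 !subr0 scalerA s2.
have uud : ul_entry * u * dr_entry = 0.
  rewrite /ul_entry /dr_entry mulrBr !mulrBl !mulNr -!scalerAl -!scalerAr.
  by rewrite sus sud cus cud !(scaler0, oppr0, addr0).
have urQ : ur_entry * Q = s *: (beta + e1).
  rewrite /ur_entry -scalerAl !mulrDl bQ e1Q.
  by rewrite (mul_corner0 PQ e2P QQ) (mul_corner0 PQ e3P QQ) !addr0.
have Qur : Q * ur_entry = s *: (beta + e2).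
  rewrite /ur_entry -scalerAr !mulrDr Qb Qe2.
  by rewrite (mul_corner0 QP QQ Pe1) (mul_corner0 QP QQ Pe3) !addr0.
rewrite /vec_entry; move: ul_entry dr_entry ur_entry (2 : K) s2 uud ul2 dr2 urQ Qur.
move=> ul dr ur two ss uud ul2 dr2 urQ Qur.
rewrite mulrBr mulrBl !mulrA uud sub0r subr0 -(mulrA u dr) dr2 ul2.
rewrite /dl_entry -!scalerAr -!scalerAl -(mulrA u) urQ Qur -!scalerAr -!scalerAl.
rewrite !scalerA mulNr mulrAC ss /corner_defect /odd_defect.
rewrite !(mulrDl, mulrDr) !(mulrN, mulNr) -!scalerAl -!scalerAr.
rewrite !(scalerDr, scalerN, scaleNr, opprD, opprK) !scalerA !mulrA ss.
by rewrite !addrA [LHS](ACl (3*1*5*7*4*6*2*8)).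
Qed.

(** With T = [corner_defect], the summands lie in different corners: T u in Q-P, u T in P-Q,
    [odd_defect u] in P-P. The odd element w has no P-P part, so the last one vanishes by itself. *)
Lemma split_odd_identity (w : A) : w * P = Q * w -> w * Q = P * w ->
    w = 2 *: (corner_defect * u + u * corner_defect) + s *: odd_defect u ->
  [/\ w * P = 2 *: (corner_defect * u), w * Q = 2 *: (u * corner_defect)
    & s *: odd_defect u = 0].
Proof.
move=> wP wQ wE.
have QT : Q * corner_defect = corner_defect.
  by rewrite /corner_defect mulrBr -scalerAr Qb mulrA Qs.
have TQ : corner_defect * Q = corner_defect.
  by rewrite /corner_defect mulrBl -scalerAl bQ -mulrA sQ.
have QuT : Q * (u * corner_defect) = 0 by rewrite mulrA; exact: odd0 uQ QP QQ QT.
have TuQ : corner_defect * u * Q = 0 by exact: odd0 uQ QP TQ QQ.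
have QD : Q * odd_defect u = 0.
  rewrite /odd_defect mulrBr -scalerAr mulrDr mulrBr !mulrA Qus Qc.
  rewrite (mul_corner0 QP QQ Pe1) (odd0 uQ QP QQ Qe2).
  by rewrite !(mul0r, addr0, scaler0, oppr0).
have DQ : odd_defect u * Q = 0.
  have e2Q0 : u * e2 * Q = 0 by rewrite -mulrA (mul_corner0 PQ e2P QQ) mulr0.
  have csuQ : c * sigma * u * Q = 0 by rewrite -!mulrA (mulrA sigma) suQ mulr0.
  have usdQ : u * sigma * d * Q = 0 by rewrite -mulrA dQ mulr0.
  rewrite /odd_defect mulrBl -scalerAl mulrDl mulrBl (odd0 uQ QP e1Q QQ).
  by rewrite e2Q0 csuQ usdQ !(addr0, scaler0, oppr0).
move: corner_defect (odd_defect u) wE QT TQ QuT TuQ QD DQ.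
move=> T D wE QT TQ QuT TuQ QD DQ.
have wP2 : w * P = 2 *: (T * u).
  by rewrite wP wE !mulrDr -!scalerAr mulrDr QuT QD scaler0 !addr0 mulrA QT.
have wQ2 : w * Q = 2 *: (u * T).
  by rewrite wE !mulrDl -!scalerAl mulrDl TuQ DQ scaler0 addr0 add0r -mulrA TQ.
split=> //; apply: (addrI w); rewrite addr0 {1}(_ : w = w * P + w * Q).
  by rewrite wP2 wQ2 -scalerDr -wE.
by rewrite -mulrDr PDQ mulr1.
Qed.

End OneVector.

Lemma scaled_vec_blocks u : s != 0 -> chirality_odd u ->
  [/\ s^-1 *: (u * dl_entry) = - alpha *: (P * u),
      s^-1 *: vec_entry u = sigma * u + u * sigma + s^-1 *: (c * u - u * d)
    & s^-1 *: - (dl_entry * u) = alpha *: (Q * u)].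
Proof.
move=> s0 [_ uQ]; rewrite vec_entryE scalerDr scalerA mulVf // scale1r /dl_entry.
by rewrite -scalerAr -scalerAl -scaleNr opprK !scalerA mulrN mulKf // uQ.
Qed.

Section TwoVectors.

Variables u v : A.
Hypotheses (u_odd : chirality_odd u) (v_odd : chirality_odd v).

Lemma rot_vec_vec_ul : u * dl_entry * (v * dl_entry) = 0.
Proof.
rewrite /dl_entry -!scalerAr -scalerAl -mulrA (mulrA Q) -v_odd.1.
by rewrite -(mulrA v) PQ !mulr0 !scaler0.
Qed.

Lemma rot_vec_vec_dr : dl_entry * u * (dl_entry * v) = 0.
Proof.
rewrite /dl_entry -!scalerAl -scalerAr -mulrA (mulrA u) u_odd.2 !mulrA QP.
by rewrite !mul0r !scaler0.
Qed.

(** Both sides are the same multiple of u sigma v, because Q removes the parts of [vec_entry] that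
    contain c and d. This handles the upper right entry of [u, v] = 0. *)
Lemma rot_vec_vec_ur :
  u * dl_entry * vec_entry v = vec_entry u * (dl_entry * v).
Proof.
rewrite /dl_entry -!scalerAr -!scalerAl -scalerAr -mulrA.
rewrite (mulrA (vec_entry u) Q) proj_vec_entry //.
by rewrite vec_entry_proj // -scalerAl -scalerAr mulrA.
Qed.

(** With the Clifford relation inserted on the right, this is the bracket [v^*, w] = -<Bv, w>
    e_+. *)
Lemma dl_entry_sym :
  u * dl_entry * v + v * dl_entry * u = - (s * alpha) *: (P * (u * v + v * u)).
Proof.
rewrite /dl_entry -!scalerAr -!scalerAl u_odd.2 v_odd.2 -scalerDr -!mulrA.
by rewrite -mulrDr.
Qed.

End TwoVectors.

Lemma commute_eplus_eminus :
  [/\ P * dl_entry = 0, dl_entry * P = 0 & P * dr_entry = ul_entry * P].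
Proof.
rewrite /dl_entry -scalerAr -scalerAl PQ QP scaler0; split=> //.
rewrite /dr_entry /ul_entry mulrBr mulrBl mulNr -scalerAr -scalerAl.
by rewrite Ps sP Pd cP scaler0 oppr0.
Qed.

End Corners.

(** * Clifford elements as matrices, and brackets in the Lie algebra *)

Lemma sqrt2_sqr (R : realType) : sqrt2 R * sqrt2 R = 2.
Proof. by rewrite -expr2 sqrtCK. Qed.

Lemma sqrt2_neq0 (R : realType) : sqrt2 R != 0.
Proof. by rewrite sqrtC_eq0 pnatr_eq0. Qed.

Lemma eucl0r (R : realType) n (v : 'cV[R]_n) : eucl v 0 = 0.
Proof. by rewrite /eucl big1 // => i _; rewrite mxE mulr0. Qed.

Lemma eucl0l (R : realType) n (v : 'cV[R]_n) : eucl 0 v = 0.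
Proof. by rewrite euclC eucl0r. Qed.

Section Generated.

Variables (K : fieldType) (m : nat) (G : 'M[K]_m -> Prop).

Lemma gen0 : generated G 0.
Proof. by rewrite -(scale0r 1%:M); apply/gen_scale/gen_one. Qed.

Lemma gen_opp x : generated G x -> generated G (- x).
Proof. by move=> Gx; rewrite -scaleN1r; apply: gen_scale. Qed.

Lemma gen_sub x y : generated G x -> generated G y -> generated G (x - y).
Proof. by move=> Gx Gy; apply/gen_add/gen_opp. Qed.

Lemma gen_scalar a : generated G a%:M.
Proof. by rewrite -scalemx1; apply/gen_scale/gen_one. Qed.

Lemma gen_prod I (r : seq I) (F : I -> 'M[K]_m) :
  (forall i, generated G (F i)) -> generated G (\big[mulmx/1%:M]_(i <- r) F i).
Proof.
move=> GF; elim: r => [|i r IH]; rewrite ?big_nil ?big_cons; first exact: gen_one.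
exact: gen_mul.
Qed.

End Generated.

Section Commutator.

Variables (K : fieldType) (m : nat).
Implicit Types x y z : 'M[K]_m.

Lemma commutatorC x y : commutator x y = - commutator y x.
Proof. by rewrite /commutator opprB. Qed.

Lemma commutatorDl x y z : commutator (x + y) z = commutator x z + commutator y z.
Proof. by rewrite /commutator mulmxDl mulmxDr opprD addrACA. Qed.

Lemma commutatorDr x y z : commutator z (x + y) = commutator z x + commutator z y.
Proof. by rewrite /commutator mulmxDl mulmxDr opprD addrACA. Qed.

Lemma commutatorZl a x y : commutator (a *: x) y = a *: commutator x y.
Proof. by rewrite /commutator -scalemxAl -scalemxAr scalerBr. Qed.

Lemma commutatorZr a x y : commutator x (a *: y) = a *: commutator x y.
Proof. by rewrite /commutator -scalemxAl -scalemxAr scalerBr. Qed.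

Lemma commutator_scalar a x : commutator a%:M x = 0.
Proof. by rewrite /commutator scalar_mxC subrr. Qed.

End Commutator.

Lemma commutator_block (K : fieldType) (m : nat)
    (a b c d a' b' c' d' : 'M[K]_m.+1) :
  commutator (block_mx a b c d) (block_mx a' b' c' d') =
  block_mx (a * a' + b * c' - (a' * a + b' * c)) (a * b' + b * d' - (a' * b + b' * d))
           (c * a' + d * c' - (c' * a + d' * c)) (c * b' + d * d' - (c' * b + d' * d)).
Proof. by rewrite /commutator !mulmx_block opp_block_mx add_block_mx. Qed.

Section BlockCommutators.

Variables (K : fieldType) (m : nat).
Implicit Types a b c d x : 'M[K]_m.+1.

Lemma commutator_upper_block x a b c d :
  commutator (block_mx 0 x 0 0) (block_mx a b c d)
  = block_mx (x * c) (x * d - a * x) 0 (- (c * x)).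
Proof. by rewrite commutator_block !(mul0r, mulr0, add0r, addr0, oppr0). Qed.

Lemma commutator_upper_triangular x a b d :
  commutator (block_mx 0 x 0 0) (block_mx a b 0 (- d))
  = block_mx 0 (- (x * d + a * x)) 0 0.
Proof. by rewrite commutator_upper_block mulr0 mul0r oppr0 mulrN -opprD. Qed.

Lemma commutator_upper_upper x a :
  commutator (block_mx 0 x 0 0) (block_mx 0 a 0 0) = 0.
Proof. by rewrite commutator_upper_block !(mulr0, mul0r, subrr, oppr0) block_mx0. Qed.

Lemma commutator_block_triangular a b c d a' b' d' :
  commutator (block_mx a b c d) (block_mx a' b' 0 (- d'))
  = block_mx (a * a' - (a' * a + b' * c)) (a * b' - b * d' - (a' * b + b' * d))
             (c * a' + d' * c) (c * b' - d * d' + d' * d).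
Proof.
by rewrite commutator_block !(mul0r, mulr0, add0r, addr0) !(mulrN, mulNr) !opprK.
Qed.

Lemma commutator_triangular a b d a' b' d' :
  commutator (block_mx a b 0 (- d)) (block_mx a' b' 0 (- d'))
  = block_mx (a * a' - a' * a) (a * b' - b * d' - (a' * b - b' * d))
             0 (d * d' - d' * d).
Proof.
by rewrite commutator_block !(mul0r, mulr0, add0r, addr0) !(mulrN, mulNr) !opprK oppr0.
Qed.

End BlockCommutators.

Lemma upper_blockZ (K : fieldType) (m : nat) (k : K) (x : 'M[K]_m) :
  block_mx 0 (k *: x) 0 0 = k *: block_mx 0 x 0 0 :> 'M_(m + m).
Proof. by rewrite scale_block_mx !scaler0. Qed.

Section RealLinear.

Variables (R : realType) (U : lmodType R) (m : nat) (f : U -> 'M[R[i]]_m).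
Hypothesis f_lin : real_linear f.

Lemma real_linear0 : f 0 = 0.
Proof. by have := f_lin (-1) 0 0; rewrite scaler0 addr0 rmorphN1 scaleN1r addNr. Qed.

Lemma real_linearD x y : f (x + y) = f x + f y.
Proof. by have := f_lin 1 x y; rewrite !scale1r. Qed.

Lemma real_linearZ a x : f (a *: x) = a%:C *: f x.
Proof. by have := f_lin a x 0; rewrite real_linear0 !addr0. Qed.

Lemma real_linearN x : f (- x) = - f x.
Proof. by rewrite -scaleN1r real_linearZ rmorphN1 scaleN1r. Qed.

End RealLinear.

(** * Schur's lemma, and Cl(W) as the 2 x 2 matrices over Cl(V) *)

Section CliffordMatrices.

Variables (R : realType) (n N : nat) (gamma : 'cV[R]_n -> 'M[R[i]]_N).

(** Over the complex numbers x has an eigenvalue, and its eigenspace is nonzero and stable under all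
    vectors. [eigenvalueP] supplies row eigenvectors, hence the transposes. *)
Lemma irreducible_schur : irreducible_action gamma ->
  forall x, (forall v, x *m gamma v = gamma v *m x) -> exists k, x = k%:M.
Proof.
move=> [N_gt0 irr] x gx.
have [k /eigenvalueP[w wk w0]] := eigenvalue_closed x^T N_gt0.
have xw : x *m w^T = k *: w^T by rewrite -[x]trmxK -trmx_mul wk linearZ.
exists k; pose f := mulmx (x - k%:M) : 'cV[R[i]]_N -> 'cV[R[i]]_N.
pose U := lker (linfun f).
have memU y : (y \in U) = (x *m y == k *: y).
  by rewrite memv_ker lfunE /f /= mulmxBl mul_scalar_mx subr_eq0.
have [v y|U0|UT] := irr U.
- rewrite !memU => /eqP xy; rewrite mulmxA gx -mulmxA xy.
  by rewrite -scalemxAr.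
- have : w^T \in U by rewrite memU xw.
  by rewrite U0 memv0 trmx_eq0 (negPf w0).
apply/matrixP => i j.
have : delta_mx j 0 \in U by rewrite UT memvf.
rewrite memU -colE => /eqP/colP/(_ i); rewrite !mxE => ->.
by rewrite eqxx andbT mulr_natr.
Qed.

Hypothesis g_lin : real_linear gamma.

Lemma ClV_gamma v : in_ClV gamma (gamma v).
Proof. by apply: gen_in; exists v. Qed.

Lemma ClV_Pi eps : in_ClV gamma (Pi gamma eps).
Proof.
apply/gen_scale/gen_add/gen_scale/gen_scale/gen_prod; first exact: gen_one.
by move=> i; apply: ClV_gamma.
Qed.

(** With [ClW_block] this identifies Cl(W) with the 2 x 2 matrices over Cl(V): parameters cut out of
    rho (e_-) are Clifford elements, and conversely the family has values in Cl(W). *)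
Lemma ClW_blocks x : in_ClW gamma x ->
  [/\ in_ClV gamma (ulsubmx x), in_ClV gamma (ursubmx x),
      in_ClV gamma (dlsubmx x) & in_ClV gamma (drsubmx x)].
Proof.
elim=> {x} [x [v [s [t ->]]]||x y _ [x1 x2 x3 x4] _ [y1 y2 y3 y4]
  |a x _ [x1 x2 x3 x4]|x y _ [x1 x2 x3 x4] _ [y1 y2 y3 y4]].
- rewrite /gammaW block_mxKul block_mxKur block_mxKdl block_mxKdr.
  split; [apply/gen_opp/ClV_gamma|exact: gen_scalar|exact: gen_scalar|exact: ClV_gamma].
- rewrite (@scalar_mx_block _ N N) block_mxKul block_mxKur block_mxKdl block_mxKdr.
  by split; [exact: gen_scalar|exact: gen0|exact: gen0|exact: gen_scalar].
- rewrite -[x]submxK -[y]submxK add_block_mx.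
  rewrite block_mxKul block_mxKur block_mxKdl block_mxKdr; split; exact: gen_add.
- rewrite -[x]submxK scale_block_mx.
  rewrite block_mxKul block_mxKur block_mxKdl block_mxKdr; split; exact: gen_scale.
rewrite -[x]submxK -[y]submxK mulmx_block.
rewrite block_mxKul block_mxKur block_mxKdl block_mxKdr.
by split; apply: gen_add; apply: gen_mul.
Qed.

Lemma gammaWE v s t : gammaW gamma v s t =
  block_mx (- gamma v) 0 0 (gamma v)
  + (s%:C * sqrt2 R) *: block_mx 0 1%:M 0 0
  - (t%:C * sqrt2 R) *: block_mx 0 0 1%:M 0.
Proof.
rewrite /gammaW; move: (s%:C * _) (t%:C * _) => x y.
rewrite !scale_block_mx opp_block_mx !add_block_mx !scaler0 !oppr0 !addr0 !add0r.
by rewrite !scalemx1 raddfN.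
Qed.

Lemma ClW_e12 : in_ClW gamma (block_mx 0 1%:M 0 0).
Proof.
have e : in_ClW gamma (gammaW gamma 0 1 0) by apply: gen_in; exists 0, 1, 0.
move: (gen_scale (sqrt2 R)^-1 e); rewrite gammaWE (real_linear0 g_lin) rmorph0 rmorph1.
rewrite oppr0 mul0r scale0r subr0 mul1r.
have -> : block_mx 0 0 0 0 = 0 :> 'M[R[i]]_(N + N) by rewrite block_mx0.
by rewrite add0r scalerA mulVf ?sqrt2_neq0 // scale1r.
Qed.

Lemma ClW_e21 : in_ClW gamma (block_mx 0 0 1%:M 0).
Proof.
have e : in_ClW gamma (gammaW gamma 0 0 1) by apply: gen_in; exists 0, 0, 1.
move: (gen_scale (- (sqrt2 R)^-1) e); rewrite gammaWE (real_linear0 g_lin) rmorph0 rmorph1.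
rewrite oppr0 mul0r scale0r addr0 mul1r.
have -> : block_mx 0 0 0 0 = 0 :> 'M[R[i]]_(N + N) by rewrite block_mx0.
by rewrite sub0r scalerN scaleNr opprK scalerA mulVf ?sqrt2_neq0 // scale1r.
Qed.

(** The null vectors act as multiples of the matrix units e12 and e21, so e11 = e12 e21 is
    available, and compressing by it isolates the upper left entry of the action of a vector. *)
Lemma ClW_ul x : in_ClV gamma x -> in_ClW gamma (block_mx x 0 0 0).
Proof.
have e11 : in_ClW gamma (block_mx 1%:M 0 0 0).
  have := gen_mul ClW_e12 ClW_e21.
  by rewrite mulmx_block !mul0mx !mulmx0 mulmx1 !add0r.
elim=> {x} [x [v ->]||x y _ IHx _ IHy|a x _ IHx|x y _ IHx _ IHy] //.
(* The upper left entry of the action of v is -v, hence the argument -v. *)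
- have gv : in_ClW gamma (gammaW gamma (- v) 0 0).
    by apply: gen_in; exists (- v), 0, 0.
  have := gen_mul e11 (gen_mul gv e11).
  rewrite gammaWE rmorph0 mul0r !scale0r addr0 subr0 (real_linearN g_lin) opprK !mulmx_block.
  by rewrite !(mul1mx, mulmx1, mul0mx, mulmx0, addr0, add0r).
- have -> : block_mx (x + y) 0 0 0 = block_mx x 0 0 0 + block_mx y 0 0 0 :> 'M_(N + N).
    by rewrite add_block_mx !addr0.
  exact: gen_add.
- have -> : block_mx (a *: x) 0 0 0 = a *: block_mx x 0 0 0 :> 'M_(N + N).
    by rewrite scale_block_mx !scaler0.
  exact: gen_scale.
have -> : block_mx (x *m y) 0 0 0 =
    block_mx x 0 0 (0 : 'M_N) *m block_mx y 0 0 0 :> 'M_(N + N).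
  by rewrite mulmx_block !(mul0mx, mulmx0, addr0).
exact: gen_mul.
Qed.

Lemma ClW_block a b c d : in_ClV gamma a -> in_ClV gamma b -> in_ClV gamma c ->
  in_ClV gamma d -> in_ClW gamma (block_mx a b c d).
Proof.
move=> /ClW_ul Wa /ClW_ul Wb /ClW_ul Wc /ClW_ul Wd.
pose e12 : 'M[R[i]]_(N + N) := block_mx 0 1%:M 0 0.
pose e21 : 'M[R[i]]_(N + N) := block_mx 0 0 1%:M 0.
have -> : block_mx a b c d = block_mx a 0 0 0 + block_mx b 0 0 0 *m e12
    + (e21 *m block_mx c 0 0 0 + e21 *m block_mx d 0 0 0 *m e12).
  rewrite !mulmx_block !add_block_mx.
  by rewrite !(mul1mx, mulmx1, mul0mx, mulmx0, addr0, add0r).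
have [We12 We21] := (ClW_e12, ClW_e21).
by apply: gen_add; apply: gen_add => //; apply: gen_mul => //; apply: gen_mul.
Qed.

End CliffordMatrices.

(** * Reduction of the representation property to brackets of generators *)

Section Brackets.

Variables (R : realType) (n m : nat) (B : 'M[R]_n).
Variable rho : cw_algebra R n -> 'M[R[i]]_m.
Hypothesis rho_lin : real_linear rho.

Lemma cw_algebra_eq (x y : cw_algebra R n) : x.1.1.1 = y.1.1.1 ->
  x.1.1.2 = y.1.1.2 -> x.1.2 = y.1.2 -> x.2 = y.2 -> x = y.
Proof.
by case: x => [[[? ?] ?] ?]; case: y => [[[? ?] ?] ?] /= -> -> -> ->.
Qed.

Lemma cw_decomp (x : cw_algebra R n) :
  x = star x.1.1.1^T + vec x.1.1.2 + x.1.2 *: eplus R n + x.2 *: eminus R n.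
Proof.
apply: cw_algebra_eq; rewrite /= ?scaler0 ?addr0 ?add0r ?trmxK //.
- by rewrite [_%:A]mulr1.
- by rewrite [_%:A]mulr1.
Qed.

Lemma bracket_star_vec v w :
  cw_bracket B (star v) (vec w) = - eucl (B *m v) w *: eplus R n.
Proof.
apply: cw_algebra_eq; rewrite /= ?scaler0 ?scale0r ?subrr ?trmxK //.
by rewrite [_%:A]mulr1 eucl0r sub0r.
Qed.

Lemma bracket_star_eminus v : cw_bracket B (star v) (eminus R n) = vec (B *m v).
Proof.
apply: cw_algebra_eq; rewrite /= ?eucl0r ?trmx0 ?mulmx0 ?scaler0 ?subrr //.
by rewrite scale1r subr0 trmxK.
Qed.

Lemma bracket_eplus_eminus : cw_bracket B (eplus R n) (eminus R n) = 0.
Proof.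
by apply: cw_algebra_eq; rewrite /= ?trmx0 ?mulmx0 ?scaler0 ?eucl0r ?subrr.
Qed.

Lemma bracket_eminus_vec v : cw_bracket B (eminus R n) (vec v) = star v.
Proof.
apply: cw_algebra_eq; rewrite /= ?trmx0 ?mulmx0 ?scaler0 ?eucl0l ?eucl0r ?subrr //.
by rewrite scale1r subr0.
Qed.

Lemma rho_bracketE x y : rho (cw_bracket B x y) =
  x.2%:C *: rho (star y.1.1.2) - y.2%:C *: rho (star x.1.1.2)
  + (y.2%:C *: rho (vec (B *m x.1.1.1^T)) - x.2%:C *: rho (vec (B *m y.1.1.1^T)))
  + ((eucl (B *m y.1.1.1^T) x.1.1.2)%:C - (eucl (B *m x.1.1.1^T) y.1.1.2)%:C)
    *: rho (eplus R n).
Proof.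
have -> : cw_bracket B x y =
    (- y.2 *: star x.1.1.2 + x.2 *: star y.1.1.2)
    + (- x.2 *: vec (B *m y.1.1.1^T) + y.2 *: vec (B *m x.1.1.1^T))
    + (eucl (B *m y.1.1.1^T) x.1.1.2 - eucl (B *m x.1.1.1^T) y.1.1.2) *: eplus R n.
  case: x => [[[phi v] r] s]; case: y => [[[psi w] r'] s'].
  apply: cw_algebra_eq; rewrite /= ?scaler0 ?addr0 ?add0r //.
  - by rewrite scaleNr addrC.
  - by rewrite scaleNr addrC.
  - by rewrite [_%:A]mulr1.
rewrite !(real_linearD rho_lin) !(real_linearZ rho_lin) !rmorphN !scaleNr rmorphB.
by rewrite [X in X + _ + _]addrC [X in _ + X + _]addrC.
Qed.

Hypotheses
  (star_star : forall v w, commutator (rho (star v)) (rho (star w)) = 0)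
  (star_vec : forall v w, commutator (rho (star v)) (rho (vec w))
    = - (eucl (B *m v) w)%:C *: rho (eplus R n))
  (star_eplus : forall v, commutator (rho (star v)) (rho (eplus R n)) = 0)
  (star_eminus : forall v,
    commutator (rho (star v)) (rho (eminus R n)) = rho (vec (B *m v)))
  (vec_vec : forall v w, commutator (rho (vec v)) (rho (vec w)) = 0)
  (eplus_vec : forall v, commutator (rho (eplus R n)) (rho (vec v)) = 0)
  (eminus_vec : forall v,
    commutator (rho (eminus R n)) (rho (vec v)) = rho (star v))
  (eplus_eminus : commutator (rho (eplus R n)) (rho (eminus R n)) = 0).

Lemma rep_of_relations x y : rho (cw_bracket B x y) = commutator (rho x) (rho y).
Proof.
have cxx z : commutator z z = 0 :> 'M[R[i]]_m by rewrite /commutator subrr.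
rewrite rho_bracketE [in RHS](cw_decomp x) [in RHS](cw_decomp y).
case: x => [[[phi v] r] s]; case: y => [[[psi w] r'] s'] /=.
rewrite !(real_linearD rho_lin) !(real_linearZ rho_lin) !commutatorDl !commutatorDr.
rewrite !commutatorZl !commutatorZr.
rewrite (commutatorC (rho (vec _)) (rho (star _))).
rewrite (commutatorC (rho (vec _)) (rho (eplus R n))).
rewrite (commutatorC (rho (vec _)) (rho (eminus R n))).
rewrite (commutatorC (rho (eplus R n)) (rho (star _))).
rewrite (commutatorC (rho (eminus R n)) (rho (star _))).
rewrite (commutatorC (rho (eminus R n)) (rho (eplus _ _))).
rewrite !(star_star, star_vec, star_eplus, star_eminus, vec_vec, eplus_vec,
  eminus_vec, eplus_eminus, cxx).
move: (rho (star w)) (rho (star v)) (rho (vec (B *m phi^T)))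
  (rho (vec (B *m psi^T))) (rho (eplus R n)) => f1 f2 h1 h2 e.
move: r%:C s%:C r'%:C s'%:C (eucl _ _)%:C (eucl _ _)%:C => a b a' b' x y.
rewrite scalerBl !(oppr0, scaler0, addr0, add0r) !scaleNr !scalerN opprK.
by rewrite !addrA [LHS](ACl (6*3*5*2*4*1)).
Qed.

End Brackets.

(** * From a representation to the family *)

Local Opaque sqrt2.

Section RepresentationToFamily.

Variables (R : realType) (n m : nat) (B : 'M[R]_n).
Variable gamma : 'cV[R]_n -> 'M[R[i]]_m.+1.
Hypotheses (n_gt0 : (0 < n)%N) (g_lin : real_linear gamma).
Hypothesis g_cliff : forall v w,
  gamma v * gamma w + gamma w * gamma v = ((- 2 * eucl v w)%:C)%:A.

Let s := sqrt2 R.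
Let s2 : s * s = 2 := sqrt2_sqr R.
Let s0 : s != 0 := sqrt2_neq0 R.

Lemma Pi_chiral_proj eps : Pi gamma eps = chiral_proj gamma eps.
Proof. by []. Qed.

Local Opaque chiral_proj.

Lemma ClV_chiral_proj eps : in_ClV gamma (chiral_proj gamma eps).
Proof. by rewrite -Pi_chiral_proj; apply: ClV_Pi. Qed.

Lemma gamma_odd eps v : ~~ odd n ->
  chirality_odd (chiral_proj gamma eps) (chiral_proj gamma (~~ eps)) (gamma v).
Proof.
move=> n_even; split; first exact: cliff_chiral_proj.
by have := cliff_chiral_proj g_lin g_cliff (~~ eps) v n_even; rewrite negbK.
Qed.

Lemma in_ClVM x y : in_ClV gamma x -> in_ClV gamma y -> in_ClV gamma (x * y).
Proof. exact: gen_mul. Qed.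

Section BlockForms.

Variables (eps : bool) (alpha rho0 : R[i]) (sigma beta c' d' e1 e2 e3 : 'M[R[i]]_m.+1).
Let P := Pi gamma eps.
Let Q := Pi gamma (~~ eps).

Lemma eminus_block_form :
  rho0%:M + block_mx (- s *: sigma - c') (s *: (beta + e1 + e2 + e3))
                     (- (s * alpha) *: Q) (s *: sigma - d')
  = rho0%:M + block_mx (ul_entry s sigma c') (ur_entry s beta e1 e2 e3)
                       (dl_entry Q s alpha) (dr_entry s sigma d') :> 'M_(m.+1 + m.+1).
Proof.
have sN : - s *: sigma = - (s *: sigma) by exact: scaleNr.
by rewrite /ul_entry /ur_entry /dl_entry /dr_entry sN; reflexivity.
Qed.

Lemma vec_block_form v : ~~ odd n ->
  block_mx (- alpha *: (P *m gamma v))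
           (sigma *m gamma v + gamma v *m sigma
            + s^-1 *: (c' *m gamma v - gamma v *m d'))
           0 (alpha *: (Q *m gamma v))
  = s^-1 *: block_mx (gamma v * dl_entry Q s alpha) (vec_entry s sigma c' d' (gamma v))
                     0 (- (dl_entry Q s alpha * gamma v)).
Proof.
move=> n_even; rewrite scale_block_mx scaler0.
have [h1 h2 h3] := scaled_vec_blocks alpha sigma c' d' s0 (gamma_odd eps v n_even).
by rewrite h1 h2 h3.
Qed.

Lemma star_block_form lambda v : B = (- 2 * lambda)%:M ->
  - (s * lambda%:C) *: block_mx 0 (gamma v) 0 0
  = s^-1 *: block_mx 0 (gamma (B *m v)) 0 0 :> 'M_(m.+1 + m.+1).
Proof.
move=> ->; have -> : gamma ((- 2 * lambda)%:M *m v) = - (s * s * lambda%:C) *: gamma v.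
  rewrite mul_scalar_mx (real_linearZ g_lin) s2 mulNr rmorphN rmorphM /=.
  by rewrite rmorph_nat.
rewrite upper_blockZ scalerA; congr (_ *: _).
by rewrite mulrN -mulrA mulKf.
Qed.

End BlockForms.

Variable rho : cw_algebra R n -> 'M[R[i]]_(m.+1 + m.+1).
Hypotheses (B_unit : B \in unitmx) (rho_rep : simple_clifford_rep B gamma rho).
Hypothesis schur :
  forall x, (forall v, x * gamma v = gamma v * x) -> exists k, x = k%:A.

Let rho_lin : real_linear rho. Proof. by case: rho_rep => [[]]. Qed.
Let rho_star v : rho (star v) = s^-1 *: block_mx 0 (gamma (B *m v)) 0 0.
Proof. by case: rho_rep => [[]]. Qed.
Let rho_bracket x y : rho (cw_bracket B x y) = commutator (rho x) (rho y).
Proof. by case: rho_rep. Qed.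

Let rho_ClW x : in_ClW gamma (rho x).
Proof. by case: rho_rep => [[]]. Qed.

Variables a b C d : 'M[R[i]]_m.+1.
Hypothesis rho_eminus : rho (eminus R n) = block_mx a b C d.

(** As B is invertible, u is the bracket of (B^-1 u)^* with e_-, so rho on V is read off from rho
    (e_-). *)
Lemma rho_vec_blocks u : rho (vec u) =
  s^-1 *: block_mx (gamma u * C) (gamma u * d - a * gamma u) 0 (- (C * gamma u)).
Proof.
rewrite -[u](mulKVmx B_unit) -bracket_star_eminus rho_bracket rho_star.
by rewrite commutatorZl rho_eminus commutator_upper_block mulKVmx.
Qed.

(** The bracket of (B^-1 u)^* with u is -|u|^2 e_+. In blocks it consists of two equal terms -u C u,
    which compensate the two factors 1/sqrt 2. A unit vector then supplies [bp]. *)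
Lemma rho_eplus_blocks : exists bp : 'M[R[i]]_m.+1,
  rho (eplus R n) = block_mx 0 bp 0 0 /\
  forall u, gamma u * C * gamma u = (eucl u u)%:C *: bp.
Proof.
have rel u : (eucl u u)%:C *: rho (eplus R n)
    = block_mx 0 (gamma u * C * gamma u) 0 0.
  have : rho (cw_bracket B (star (invmx B *m u)) (vec u))
      = - (eucl u u)%:C *: rho (eplus R n).
    by rewrite bracket_star_vec mulKVmx // real_linearZ // rmorphN.
  rewrite rho_bracket rho_star rho_vec_blocks mulKVmx // commutatorZl commutatorZr.
  rewrite commutator_upper_triangular scalerA -invfM s2 mulrA scale_block_mx !scaler0 scalerN.
  rewrite scale_halfD scaleNr => e; apply: oppr_inj; rewrite -e.
  by rewrite opp_block_mx !oppr0.
pose e1 : 'cV[R]_n := delta_mx (Ordinal n_gt0) 0.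
have e11 : eucl e1 e1 = 1 by rewrite eucl_delta_l mxE !eqxx.
have rho_e : rho (eplus R n) = block_mx 0 (gamma e1 * C * gamma e1) 0 0.
  by rewrite -rel e11 scale1r.
exists (gamma e1 * C * gamma e1); split=> // u.
have := rel u; rewrite rho_e scale_block_mx => /eq_block_mx[_ h _ _].
by rewrite -h.
Qed.

Lemma eplus_eminus_blocks bp : rho (eplus R n) = block_mx 0 bp 0 0 ->
  [/\ bp * C = 0, C * bp = 0 & bp * d = a * bp].
Proof.
move=> rho_e; have := rho_bracket (eplus R n) (eminus R n).
rewrite bracket_eplus_eminus real_linear0 // rho_e rho_eminus commutator_upper_block.
rewrite -[LHS]block_mx0.
move=> /eq_block_mx[h1 h2 _ /eqP h4]; split=> //.
  by apply/eqP; rewrite -oppr_eq0 eq_sym.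
by apply/eqP; rewrite -subr_eq0 -h2.
Qed.

Lemma eminus_vec_blocks u :
  [/\ a * (gamma u * C) - (gamma u * C * a + (gamma u * d - a * gamma u) * C) = 0,
      a * (gamma u * d - a * gamma u) - b * (C * gamma u)
        - (gamma u * C * b + (gamma u * d - a * gamma u) * d) = gamma (B *m u)
    & C * (gamma u * d - a * gamma u) - d * (C * gamma u) + C * gamma u * d = 0].
Proof.
have := rho_bracket (eminus R n) (vec u).
rewrite bracket_eminus_vec rho_vec_blocks rho_star commutatorZr rho_eminus.
have sV0 : s^-1 != 0 by rewrite invr_eq0.
move/(scalerI sV0); rewrite commutator_block_triangular.
by move=> /eq_block_mx[h1 h2 _ h4]; split.
Qed.

Lemma rep_corner_family : rho (eplus R n) != 0 ->
  ~~ odd n /\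
  exists lambda : R, B = (- 2 * lambda)%:M /\
  exists (eps : bool) (alpha rho0 : R[i]) (beta sigma c' d' e1 e2 e3 : 'M[R[i]]_m.+1),
    corner_family gamma lambda eps alpha rho0 beta sigma c' d' e1 e2 e3 rho.
Proof.
have [bp [rho_e uCu]] := rho_eplus_blocks.
have [bpC Cbp bpd] := eplus_eminus_blocks rho_e.
rewrite rho_e => e_neq0.
have bp0 : bp != 0.
  by apply: contraNneq e_neq0 => ->; rewrite block_mx0.
have [n_even [eps [k [k0 bpE CE]]]] := sandwich_chiral g_lin g_cliff schur uCu bpC bp0.
split=> //; have PDQ := chiral_projD gamma eps; have PQ := chiral_projM g_cliff eps.
have QP := chiral_projMC g_cliff eps; have g_odd v := gamma_odd eps v n_even.
have [ClVP ClVQ] := (ClV_chiral_proj eps, ClV_chiral_proj (~~ eps)).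
have symbol T := @chiral_symbol_scalar R n _ gamma g_lin g_cliff B T eps n_gt0 n_even.
have PiE := Pi_chiral_proj.
move: (chiral_proj gamma eps) (chiral_proj gamma (~~ eps)) (PiE eps) (PiE (~~ eps))
  bpE CE PDQ PQ QP g_odd ClVP ClVQ symbol.
move=> P Q PE QE bpE CE PDQ PQ QP g_odd ClVP ClVQ symbol {PiE}.
have two0 : (2 : R[i]) != 0 by rewrite pnatr_eq0.
have Nk0 : - k != 0 by rewrite oppr_eq0.
have Pd : P * d = a * P.
  by apply: (scalerI k0); rewrite scalerAl scalerAr -bpE.
have [rho0 [aE dE]] : exists rho0 : R[i],
    a = rho0%:A + (rho0 *: Q - Q * d * Q + P * a * Q) /\
    d = rho0%:A + (Q * d * Q - rho0 *: Q + Q * d * P).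
  apply: (rot_diagonal_blocks PDQ PQ QP schur g_odd Nk0 two0 Pd) => v.
    by have [h _ _] := eminus_vec_blocks v; rewrite CE in h.
  by have [_ _ h] := eminus_vec_blocks v; rewrite CE in h.
have [PP QQ] := corner_idem PDQ PQ QP.
have sandwich (l : R[i]) (x y z : 'M[R[i]]_m.+1) : x * x = x -> z * z = z ->
    l *: (x * y * z) = x * (l *: (x * y * z)) * z.
  move=> xx zz; rewrite -scalerAr -scalerAl !mulrA xx.
  by rewrite -(mulrA _ z) zz.
have ClVX (l : R[i]) (x y z : 'M[R[i]]_m.+1) :
    in_ClV gamma x -> in_ClV gamma y -> in_ClV gamma z -> in_ClV gamma (l *: (x * y * z)).
  by move=> Vx Vy Vz; apply: gen_scale; apply: in_ClVM => //; apply: in_ClVM.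
have [ClVa ClVb ClVC ClVd] : [/\ in_ClV gamma a, in_ClV gamma b,
    in_ClV gamma C & in_ClV gamma d].
  have := ClW_blocks (rho_ClW (eminus R n)); rewrite rho_eminus.
  by rewrite block_mxKul block_mxKur block_mxKdl block_mxKdr.
have typed l x y z (xx : x * x = x) (zz : z * z = z) Vx Vy Vz :=
  conj (ClVX l x y z Vx Vy Vz) (sandwich l x y z xx zz).
have ClVd' : in_ClV gamma (d - rho0%:A).
  by apply: gen_sub => //; apply/gen_scale/gen_one.
(* The free corner Q d Q - rho0 Q is sqrt 2 sigma. The factor -1 for [c'] and [d'] comes from their
   sign in [ul_entry] and [dr_entry]. *)
have sigmaT := typed s^-1 _ _ _ QQ QQ ClVQ ClVd' ClVQ.
have betaT := typed s^-1 _ _ _ QQ QQ ClVQ ClVb ClVQ.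
have c'T := typed (-1) _ _ _ PP QQ ClVP ClVa ClVQ.
have d'T := typed (-1) _ _ _ QQ PP ClVQ ClVd ClVP.
have e1T := typed s^-1 _ _ _ PP QQ ClVP ClVb ClVQ.
have e2T := typed s^-1 _ _ _ QQ PP ClVQ ClVb ClVP.
have e3T := typed s^-1 _ _ _ PP PP ClVP ClVb ClVP.
have sKV x : s *: (s^-1 *: x) = x :> 'M[R[i]]_m.+1 by rewrite scalerA mulfV // scale1r.
have {}aE : a = rho0%:A + ul_entry s (s^-1 *: (Q * (d - rho0%:A) * Q)) (-1 *: (P * a * Q)).
  rewrite /ul_entry sKV scaleN1r opprK mulrBr mulrBl -scalerAr mulr1 -scalerAl QQ opprB.
  exact: aE.
have {}dE : d = rho0%:A + dr_entry s (s^-1 *: (Q * (d - rho0%:A) * Q)) (-1 *: (Q * d * P)).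
  rewrite /dr_entry sKV scaleN1r opprK mulrBr mulrBl -scalerAr mulr1 -scalerAl QQ.
  exact: dE.
have {}bE : b = ur_entry s (s^-1 *: (Q * b * Q)) (s^-1 *: (P * b * Q))
    (s^-1 *: (Q * b * P)) (s^-1 *: (P * b * P)).
  exact: corner_ur_entry.
move: (s^-1 *: (Q * (_ - _) * Q)) sigmaT aE dE => sigma [ClVs sigmaE] aE dE.
move: (-1 *: (P * a * Q)) c'T aE => c' [ClVc' c'E] aE.
move: (-1 *: (Q * d * P)) d'T dE => d' [ClVd'' d'E] dE.
move: (s^-1 *: (Q * b * Q)) (s^-1 *: (P * b * Q)) (s^-1 *: (Q * b * P))
  (s^-1 *: (P * b * P)) betaT e1T e2T e3T bE.
move=> beta e1 e2 e3 [ClVbeta betaE] [ClVe1 e1E] [ClVe2 e2E] [ClVe3 e3E] bE.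
pose alpha := s^-1 * k.
have k_sa : k = s * alpha by rewrite /alpha mulrA mulfV // mul1r.
have alpha0 : alpha != 0 by rewrite mulf_neq0 ?invr_eq0.
clearbody alpha.
have {}CE : C = dl_entry Q s alpha by rewrite CE k_sa.
have FE v : gamma v * d - a * gamma v = vec_entry s sigma c' d' (gamma v).
  rewrite aE dE /vec_entry mulrDr mulrDl opprD addrACA -scalerAr -scalerAl.
  by rewrite mulr1 mul1r subrr add0r.
have eq12 v : gamma (B *m v) =
    2 *: (corner_defect alpha sigma beta * gamma v
          + gamma v * corner_defect alpha sigma beta)
    + s *: odd_defect s alpha sigma c' d' e1 e2 (gamma v).
  have [_ <- _] := eminus_vec_blocks v; rewrite FE.
  rewrite -(rot_ur_vec PDQ PQ QP alpha s2 sigmaE betaE c'E d'E e1E e2E e3E (g_odd v)).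
  rewrite aE dE bE CE; move: (vec_entry _ _ _ _ _) (ul_entry _ _ _) (ur_entry _ _ _ _ _).
  move: (dl_entry _ _ _) (dr_entry _ _ _) => dl dr F ul ur.
  rewrite [in LHS]mulrDl [in LHS](mulrDr F) -scalerAl -scalerAr mulr1 mul1r.
  move: (rho0 *: F) (ul * F) (F * dr) => x y z.
  move: (_ * (_ * _)) (_ * _ * _) => w t.
  rewrite !opprD !addrA [LHS](ACl (2*3*4*6*1*5)) /=.
  by rewrite addrK.
have splitE v := split_odd_identity PDQ PQ QP sigmaE betaE c'E d'E e1E e2E (g_odd v)
  (g_odd (B *m v)).1 (g_odd (B *m v)).2 (eq12 v).
(* [TE] reads alpha beta - sigma^2 = -lambda Q, the equation between sigma and beta in the
   family. *)
have [lambda [BE TE]] := symbol _ (fun v => let: And3 h _ _ := splitE v in h)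
  (fun v => let: And3 _ h _ := splitE v in h).
exists lambda; split=> //.
exists eps, alpha, rho0, beta, sigma, c', d', e1, e2, e3.
have odd0 v : odd_defect s alpha sigma c' d' e1 e2 (gamma v) = 0.
  by have [_ _ h] := splitE v; apply: (scalerI s0); rewrite scaler0.
rewrite /corner_family /block_types PE QE; split.
- by split=> //; split.
- split=> //; change (sigma * sigma = alpha *: beta + lambda%:C *: Q).
  rewrite -[lambda%:C]opprK scaleNr -TE /corner_defect opprB addrC subrK //.
- by move=> v; apply/subr0_eq/odd0.
- split=> [v|]; first by rewrite star_block_form // rho_star.
  by rewrite rho_e bpE scale_block_mx !scaler0 k_sa.
split; first rewrite -QE eminus_block_form rho_eminus QE -bE -CE.
  have aE' : rho0%:M + ul_entry s sigma c' = a by rewrite [RHS]aE scalemx1.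
  have dE' : rho0%:M + dr_entry s sigma d' = d by rewrite [RHS]dE scalemx1.
  by rewrite scalar_mx_block add_block_mx !add0r aE' dE'.
by move=> v; rewrite -PE -QE vec_block_form // rho_vec_blocks FE CE QE.
Qed.

End RepresentationToFamily.

(** * From the family to a representation *)

Local Opaque chiral_proj.

Section FamilyToRepresentation.

Variables (R : realType) (n m : nat) (B : 'M[R]_n).
Variable gamma : 'cV[R]_n -> 'M[R[i]]_m.+1.
Hypotheses (n_gt0 : (0 < n)%N) (g_lin : real_linear gamma).
Hypothesis g_cliff : forall v w,
  gamma v * gamma w + gamma w * gamma v = ((- 2 * eucl v w)%:C)%:A.

Let s := sqrt2 R.
Let s2 : s * s = 2 := sqrt2_sqr R.
Let s0 : s != 0 := sqrt2_neq0 R.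

Section Converse.

Variables (lambda : R) (eps : bool) (alpha rho0 : R[i]).
Variables (beta sigma c' d' e1 e2 e3 : 'M[R[i]]_m.+1).
Variable rho : cw_algebra R n -> 'M[R[i]]_(m.+1 + m.+1).
Hypotheses (n_even : ~~ odd n) (BE : B = (- 2 * lambda)%:M).
Hypothesis rho_family :
  corner_family gamma lambda eps alpha rho0 beta sigma c' d' e1 e2 e3 rho.

Lemma corner_family_rep :
  simple_clifford_rep B gamma rho /\ rho (eplus R n) != 0.
Proof.
case: rho_family; rewrite /block_types -/s.
set P := Pi gamma eps; set Q := Pi gamma (~~ eps).
case=> rho_lin [[Vc c'E] [Vd d'E] [Ve1 e1E] [Ve2 e2E] [Ve3 e3E]].
case=> alpha0 [Vb betaE] [Vs sigmaE] sigma2 rel [rho_star rho_eplus] [rho_eminus rho_vec].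
have {}rho_star v : rho (star v) = s^-1 *: block_mx 0 (gamma (B *m v)) 0 0.
  exact: etrans (rho_star v) (star_block_form g_lin v BE).
pose dl := dl_entry Q s alpha; pose ul := ul_entry s sigma c'.
pose dr := dr_entry s sigma d'; pose ur := ur_entry s beta e1 e2 e3.
pose F v := vec_entry s sigma c' d' (gamma v).
have {}rho_vec v : rho (vec v)
    = s^-1 *: block_mx (gamma v * dl) (F v) 0 (- (dl * gamma v)).
  exact: etrans (rho_vec v) (vec_block_form g_lin g_cliff _ _ _ _ _ _ n_even).
have {}rho_eminus : rho (eminus R n) = rho0%:M + block_mx ul ur dl dr.
  by rewrite rho_eminus; exact: eminus_block_form.
have PDQ : P + Q = 1 by exact: chiral_projD.
have PQ : P * Q = 0 by exact: (chiral_projM g_cliff).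
have QP : Q * P = 0 by exact: (chiral_projMC g_cliff).
have g_odd v : chirality_odd P Q (gamma v) by exact: (gamma_odd g_lin g_cliff).
have P0 : P != 0 by exact: (chiral_proj_neq0 g_lin g_cliff eps n_gt0 n_even).
have [VP VQ] : in_ClV gamma P /\ in_ClV gamma Q by split; apply: ClV_Pi.
have gB v : gamma (B *m v) = (- 2 * lambda%:C) *: gamma v.
  by rewrite BE mul_scalar_mx (real_linearZ g_lin) rmorphM rmorphN rmorph_nat.
(* With corner defect -lambda Q and odd defect 0, the identity becomes -2 lambda (Q v + v Q) = -2
   lambda v = Bv, as v Q = P v. *)
have rotE v : ul * F v - ur * (dl * gamma v) - (gamma v * dl * ur + F v * dr)
    = gamma (B *m v).
  rewrite (rot_ur_vec PDQ PQ QP alpha s2 sigmaE betaE c'E d'E e1E e2E e3E (g_odd v)).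
  have -> : odd_defect s alpha sigma c' d' e1 e2 (gamma v) = 0.
    by apply/eqP; rewrite subr_eq0; apply/eqP; exact: rel.
  have -> : corner_defect alpha sigma beta = - lambda%:C *: Q.
    rewrite /corner_defect; have -> : sigma * sigma = _ := sigma2.
    by rewrite opprD addrA subrr sub0r scaleNr.
  rewrite gB scaler0 addr0 -scalerAl -scalerAr -scalerDr scalerA mulrN mulNr.
  by rewrite (g_odd v).2 -mulrDl addrC PDQ mul1r.
have ul_vec v : ul * (gamma v * dl) - (gamma v * dl * ul + F v * dl) = 0.
  exact: (rot_ul_vec PDQ PQ QP s alpha sigmaE c'E d'E (g_odd v)).
have dl_vec v : dl * (gamma v * dl) = 0.
  exact: (rot_dl_vec PDQ PQ QP s alpha (g_odd v)).
have dl_vec2 v : dl * gamma v * dl = 0 by rewrite -mulrA; exact: dl_vec.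
have dr_vec v : dl * F v - dr * (dl * gamma v) + dl * gamma v * dr = 0.
  exact: (rot_dr_vec PDQ PQ QP s alpha sigmaE c'E d'E (g_odd v)).
have vv_ul v w : gamma v * dl * (gamma w * dl) = 0.
  exact: (rot_vec_vec_ul PQ s alpha (gamma v) (g_odd w)).
have vv_dr v w : dl * gamma v * (dl * gamma w) = 0.
  exact: (rot_vec_vec_dr QP s alpha (gamma w) (g_odd v)).
have vv_ur v w : gamma v * dl * F w - F v * (dl * gamma w) = 0.
  apply/eqP; rewrite subr_eq0; apply/eqP.
  exact: (rot_vec_vec_ur PDQ PQ QP s alpha sigmaE c'E d'E (g_odd v) (g_odd w)).
have sym v w : gamma v * dl * gamma w + gamma w * dl * gamma v
    = - (s * alpha) *: (P * (gamma v * gamma w + gamma w * gamma v)).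
  exact: (dl_entry_sym s alpha (g_odd v) (g_odd w)).
have [Pdl dlP Pdr] : [/\ P * dl = 0, dl * P = 0 & P * dr = ul * P].
  exact: (commute_eplus_eminus PDQ PQ QP s alpha sigmaE c'E d'E).
have Vdl : in_ClV gamma dl by apply: gen_scale.
have Vul : in_ClV gamma ul by apply: gen_sub => //; apply/gen_opp/gen_scale.
have Vdr : in_ClV gamma dr by apply: gen_sub => //; apply: gen_scale.
have Vur : in_ClV gamma ur.
  by apply: gen_scale; apply: gen_add => //; apply: gen_add => //; apply: gen_add.
have Vg v : in_ClV gamma (gamma v) by exact: ClV_gamma.
have VF v : in_ClV gamma (F v) by apply: gen_sub; apply: in_ClVM.
have star_F v : gamma v * dr - ul * gamma v = F v by [].
have sE : s = sqrt2 R by [].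
clear rel sigma2; clearbody F ul dl dr ur P Q; clearbody s2 s0; clearbody s.
have sa0 : s * alpha != 0 by rewrite mulf_neq0.
have bracket x y : rho (cw_bracket B x y) = commutator (rho x) (rho y).
  apply: rep_of_relations => // [v w|v w|v|v|v w|v|v|].
  - by rewrite !rho_star commutatorZl commutatorZr commutator_upper_upper !scaler0.
  - rewrite rho_star rho_vec rho_eplus commutatorZl commutatorZr.
    rewrite commutator_upper_triangular (mulrA (gamma _)) sym g_cliff.
    rewrite -scaleNr -scalerAr mulr1 !upper_blockZ !scalerA; congr (_ *: _).
    rewrite opprK rmorphM rmorphN rmorph_nat /= -s2.
    by move: (eucl _ _)%:C => k; field.
  - by rewrite rho_star rho_eplus commutatorZl commutatorZr commutator_upper_upper !scaler0.
  - rewrite rho_star rho_eminus commutatorZl commutatorDr commutatorC.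
    by rewrite commutator_scalar oppr0 add0r commutator_upper_block rho_vec star_F.
  - rewrite !rho_vec commutatorZl commutatorZr commutator_triangular.
    rewrite (vv_ul v w) (vv_ul w v) (vv_dr v w) (vv_dr w v) (vv_ur v w) (vv_ur w v).
    by rewrite subr0 block_mx0 !scaler0.
  - rewrite rho_eplus rho_vec commutatorZl commutatorZr commutator_upper_triangular.
    by rewrite mulrA Pdl -mulrA dlP mul0r mulr0 addr0 oppr0 block_mx0 !scaler0.
  - rewrite rho_eminus rho_vec rho_star commutatorDl commutatorZr commutator_scalar.
    rewrite scaler0 add0r commutatorZr commutator_block_triangular.
    by rewrite (ul_vec v) (dl_vec v) (dl_vec2 v) (rotE v) (dr_vec v) addr0.
  rewrite rho_eplus rho_eminus commutatorZl commutatorDr commutatorC commutator_scalar.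
  by rewrite oppr0 add0r commutator_upper_block Pdl dlP Pdr subrr oppr0 block_mx0 scaler0.
have rho_ClW x : in_ClW gamma (rho x).
  have V0 : in_ClV gamma 0 by exact: gen0.
  rewrite (cw_decomp x) !(real_linearD rho_lin) !(real_linearZ rho_lin).
  rewrite rho_star rho_vec rho_eplus rho_eminus.
  have W := ClW_block g_lin.
  apply: gen_add; last first.
    by apply/gen_scale/gen_add; [exact: gen_scalar|exact: W].
  apply: gen_add; last by do 2! apply: gen_scale; exact: W.
  apply: gen_add; first by apply: gen_scale; apply: W.
  by apply: gen_scale; apply: W => //; [|apply: gen_opp]; apply: in_ClVM.
split; last first.
  rewrite rho_eplus scaler_eq0 (negPf sa0) /=.
  apply: contraNneq P0 => e; have := congr1 ursubmx e; rewrite block_mxKur => ->.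
  by apply/eqP/matrixP => i j; rewrite !mxE.
by split=> //; split=> // v; rewrite -sE.
Qed.

End Converse.

(** * Scalar parameters inside the corner family *)

Section ScalarCorners.

Variables (lambda : R) (eps : bool) (alpha beta rho0 sigma : R[i]).
Variables (c' d' e1 e2 e3 : 'M[R[i]]_m.+1).
Variable rho : cw_algebra R n -> 'M[R[i]]_(m.+1 + m.+1).
Hypothesis n_even : ~~ odd n.

Let P := Pi gamma eps.
Let Q := Pi gamma (~~ eps).

(** From v Q = P v one gets Q v + v Q = v: the scalar formula for rho (v) therefore shows sigma v
    without a projector. *)
Lemma scalar_corner_vec v :
  (sigma *: Q) *m gamma v + gamma v *m (sigma *: Q) = sigma *: gamma v.
Proof.
have [_ h] := gamma_odd g_lin g_cliff eps v n_even.
rewrite -scalemxAl -scalemxAr -scalerDr; congr (_ *: _).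
have -> : gamma v *m Q = P *m gamma v by exact: h.
have PDQ : P + Q = 1%:M by exact: chiral_projD.
by rewrite -mulmxDl addrC PDQ mul1mx.
Qed.

Lemma scalar_corner_rel v : c' = P *m c' *m Q -> d' = Q *m d' *m P ->
  c' *m (sigma *: Q) *m gamma v - gamma v *m (sigma *: Q) *m d'
  = sigma *: (c' *m gamma v - gamma v *m d').
Proof.
move=> c'E d'E; have [cQ Qd] : c' * Q = c' /\ Q * d' = d'.
  have PP : P * P = P by exact: (chiral_proj_idem g_cliff).
  have QQ : Q * Q = Q by exact: (chiral_proj_idem g_cliff).
  by split; [exact: (corner_absorb PP QQ c'E).2|exact: (corner_absorb QQ PP d'E).1].
clear c'E d'E; clearbody Q.
have h1 : c' * (sigma *: Q) * gamma v = sigma *: (c' * gamma v).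
  by rewrite -scalerAr -scalerAl cQ.
have h2 : gamma v * (sigma *: Q) * d' = sigma *: (gamma v * d').
  by rewrite -scalerAr -scalerAl -(mulrA (gamma v)) Qd.
change (c' * (sigma *: Q) * gamma v - gamma v * (sigma *: Q) * d'
        = sigma *: (c' * gamma v - gamma v * d')).
by rewrite h1 h2 scalerBr.
Qed.

(** The equation for sigma^2 stands beside the corner family because the latter yields it only
    multiplied by Q. *)
Lemma scalar_family_corner :
  scalar_family gamma lambda eps alpha beta rho0 sigma c' d' e1 e2 e3 rho <->
  sigma ^+ 2 = alpha * beta + lambda%:C /\
  corner_family gamma lambda eps alpha rho0 (beta *: Q) (sigma *: Q)
    c' d' e1 e2 e3 rho.
Proof.
have QQ : Q *m Q = Q by exact: (chiral_proj_idem g_cliff).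
have VQ k : in_ClV gamma (k *: Q) by apply/gen_scale/ClV_Pi.
have QkQ k : k *: Q = Q *m (k *: Q) *m Q by exact: idem_scale_corner.
have em1 : - sqrt2 R *: (sigma *: Q) = - (sqrt2 R * sigma) *: Q.
  by rewrite scalerA mulNr.
have em2 : sqrt2 R *: (sigma *: Q) = (sqrt2 R * sigma) *: Q by rewrite scalerA.
have ss : (sigma *: Q) *m (sigma *: Q) = sigma ^+ 2 *: Q.
  by rewrite expr2; exact: idem_scale_mul.
rewrite /scalar_family /corner_family -/P -/Q em1 em2; split.
  case=> [[rho_lin types] [alpha0 sigma2] rel stp [emE vecE]].
  have [[_ c'E] [_ d'E] _ _ _] := types.
  split; [exact: sigma2|split].
  - exact: conj rho_lin types.
  - split; [exact: alpha0|exact: conj (VQ beta) (QkQ beta)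
      |exact: conj (VQ sigma) (QkQ sigma)|].
    by rewrite ss sigma2 scalerDl scalerA; reflexivity.
  - by move=> v; exact: etrans (rel v) (esym (scalar_corner_rel v c'E d'E)).
  - exact: stp.
  - by split; [exact: emE|move=> v; rewrite scalar_corner_vec; exact: vecE].
case=> sigma2 [[rho_lin types] [alpha0 _ _ _] rel stp [emE vecE]].
have [[_ c'E] [_ d'E] _ _ _] := types.
split.
- exact: conj rho_lin types.
- exact: conj alpha0 sigma2.
- by move=> v; exact: etrans (rel v) (scalar_corner_rel v c'E d'E).
- exact: stp.
- split; [exact: emE|move=> v]; have := vecE v; rewrite scalar_corner_vec; exact.
Qed.

End ScalarCorners.

Section ChiralBlocks.

Variables (lambda : R) (eps : bool) (alpha rho0 : R[i]).
Variables (beta sigma c' d' e1 e2 e3 : 'M[R[i]]_m.+1).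
Variable rho : cw_algebra R n -> 'M[R[i]]_(m.+1 + m.+1).
Hypothesis rho_family :
  corner_family gamma lambda eps alpha rho0 beta sigma c' d' e1 e2 e3 rho.

Let P := Pi gamma eps.
Let Q := Pi gamma (~~ eps).

(** The P-P block is always scalar and the Q-Q block carries sigma, so [scalar_chiral_blocks]
    amounts to sigma being a multiple of Q. *)
Lemma corner_family_chiral_blocks :
  P *m ulsubmx (rho (eminus R n)) *m P = rho0 *: P /\
  Q *m ulsubmx (rho (eminus R n)) *m Q = rho0 *: Q - s *: sigma.
Proof.
case: rho_family; rewrite /block_types -/s -/P -/Q.
case=> _ [[_ c'E] _ _ _ _] [_ _ [_ sigmaE] _] _ _ [-> _].
have PDQ : P + Q = 1 by exact: chiral_projD.
have PQ : P * Q = 0 by exact: (chiral_projM g_cliff).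
have QP : Q * P = 0 by exact: (chiral_projMC g_cliff).
have [PP QQ] := corner_idem PDQ PQ QP.
have [Pc cQ] := corner_absorb PP QQ c'E.
have [Qs sQ] := corner_absorb QQ QQ sigmaE.
have sP : sigma * P = 0 by exact: mul_corner0 QP sQ PP.
have cP : c' * P = 0 by exact: mul_corner0 QP cQ PP.
have Qc : Q * c' = 0 by exact: mul_corner0 QP QQ Pc.
rewrite scalar_mx_block add_block_mx block_mxKul -scalemx1.
clear c'E sigmaE; clearbody P Q.
change (P * (rho0%:A + (- s *: sigma - c')) * P = rho0 *: P /\
        Q * (rho0%:A + (- s *: sigma - c')) * Q = rho0 *: Q - s *: sigma).
split.
  rewrite -mulrA mulrDl mulrBl -!scalerAl mul1r sP cP scaler0 subr0 addr0.
  by rewrite -scalerAr PP.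
rewrite mulrDr mulrBr -!scalerAr mulr1 Qs Qc subr0 mulrDl.
by rewrite -!scalerAl QQ sQ scaleNr.
Qed.

End ChiralBlocks.

Lemma corner_family_scalar lambda eps alpha rho0
    (beta sigma c' d' e1 e2 e3 : 'M[R[i]]_m.+1) rho : ~~ odd n ->
    corner_family gamma lambda eps alpha rho0 beta sigma c' d' e1 e2 e3 rho ->
    scalar_chiral_blocks gamma (rho (eminus R n)) ->
  exists beta' sigma' : R[i],
    scalar_family gamma lambda eps alpha beta' rho0 sigma' c' d' e1 e2 e3 rho.
Proof.
move=> n_even fam /(_ (~~ eps))[mu mu_eq].
have [_ QE] := corner_family_chiral_blocks fam.
have sigmaE : sigma = (s^-1 * (rho0 - mu)) *: Pi gamma (~~ eps).
  move: QE; rewrite mu_eq => QE; apply: (scalerI s0).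
  rewrite scalerA mulrA mulfV // mul1r scalerBl QE opprB addrC subrK //.
have alpha0 : alpha != 0 by case: fam => _ [].
move: (s^-1 * _) sigmaE => sigma' sigmaE.
(* As alpha is nonzero, the corner equation expresses beta through sigma^2, so beta is scalar once
   sigma is. *)
have betaE : beta = (alpha^-1 * (sigma' ^+ 2 - lambda%:C)) *: Pi gamma (~~ eps).
  case: fam => _ [_ _ _]; rewrite sigmaE.
  have -> : (sigma' *: Pi gamma (~~ eps)) *m (sigma' *: Pi gamma (~~ eps))
      = (sigma' * sigma') *: Pi gamma (~~ eps).
    exact: idem_scale_mul (chiral_proj_idem g_cliff _).
  rewrite -expr2 => h _ _ _; apply: (scalerI alpha0).
  by rewrite scalerA mulrA mulfV // mul1r scalerBl h addrK.
exists (alpha^-1 * (sigma' ^+ 2 - lambda%:C)), sigma'.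
apply/scalar_family_corner => //; rewrite -betaE -sigmaE; split=> //.
by rewrite mulrA mulfV // mul1r subrK.
Qed.

Lemma scalar_family_chiral_blocks lambda eps alpha beta rho0 sigma
    (c' d' e1 e2 e3 : 'M[R[i]]_m.+1) rho : ~~ odd n ->
    scalar_family gamma lambda eps alpha beta rho0 sigma c' d' e1 e2 e3 rho ->
  scalar_chiral_blocks gamma (rho (eminus R n)).
Proof.
move=> n_even /(scalar_family_corner _ _ _ _ _ _ _ _ _ _ _ _ n_even)[_ fam].
have [PE QE] := corner_family_chiral_blocks fam => e.
have [->|->] : e = eps \/ e = ~~ eps by case: (e) (eps) => [] []; [left|right|right|left].
  by exists rho0.
exists (rho0 - s * sigma); move: QE.
by move: (Pi gamma (~~ eps)) => Q ->; rewrite scalerA scalerBl; reflexivity.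
Qed.

End FamilyToRepresentation.

Theorem theorem3p7 (R : realType) (n N : nat) (B : 'M[R]_n)
    (gamma : 'cV[R]_n -> 'M[R[i]]_N)
    (n_gt0 : (0 < n)%N)
    (B_sym : forall v w, eucl (B *m v) w = eucl v (B *m w))
    (B_nondeg : B \in unitmx)
    (gamma_clifford : clifford_action gamma)
    (gamma_irr : irreducible_action gamma)
    (rho : cw_algebra R n -> 'M[R[i]]_(N + N)) :
  [/\ simple_clifford_rep B gamma rho -> rho (eplus R n) != 0 ->
        ~~ odd n /\ exists lambda : R, B = (- 2 * lambda)%:M,
      (simple_clifford_rep B gamma rho /\ rho (eplus R n) != 0) /\
        scalar_chiral_blocks gamma (rho (eminus R n))
      <->
      ~~ odd n /\
      exists lambda : R, B = (- 2 * lambda)%:M /\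
      exists (eps : bool) (alpha beta rho0 sigma : R[i])
             (c' d' e1 e2 e3 : 'M[R[i]]_N),
        scalar_family gamma lambda eps alpha beta rho0 sigma
          c' d' e1 e2 e3 rho
    & simple_clifford_rep B gamma rho /\ rho (eplus R n) != 0
      <->
      ~~ odd n /\
      exists lambda : R, B = (- 2 * lambda)%:M /\
      exists (eps : bool) (alpha rho0 : R[i])
             (beta sigma c' d' e1 e2 e3 : 'M[R[i]]_N),
        corner_family gamma lambda eps alpha rho0 beta sigma
          c' d' e1 e2 e3 rho].
Proof.
have N_gt0 := gamma_irr.1.
(* A positive size makes the square matrices a nontrivial ring, as the abstract results require. *)
case: N gamma gamma_clifford gamma_irr rho N_gt0 => // m gamma.
move=> gamma_clifford gamma_irr rho _; have [g_lin g_cl] := gamma_clifford.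
have g_cliff v w : gamma v * gamma w + gamma w * gamma v = ((- 2 * eucl v w)%:C)%:A.
  by rewrite [RHS]scalemx1; exact: g_cl.
have schur x : (forall v, x * gamma v = gamma v * x) -> exists k, x = k%:A.
  move=> /(irreducible_schur gamma_irr)[k ->]; exists k.
  by rewrite [RHS]scalemx1.
have fwd rho_rep := rep_corner_family n_gt0 g_lin g_cliff B_nondeg rho_rep schur
  (esym (submxK (rho (eminus R n)))).
split.
- move=> rho_rep e0; have [n_even [lambda [BE _]]] := fwd rho_rep e0.
  by split=> //; exists lambda.
- split=> [[[rho_rep e0] blocks]|].
    have [n_even [lambda [BE [eps [alpha [rho0 [beta [sigma fam]]]]]]]] := fwd rho_rep e0.
    have [c' [d' [e1 [e2 [e3 {}fam]]]]] := fam.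
    have [beta' [sigma' fam']] := corner_family_scalar g_lin g_cliff n_even fam blocks.
    split=> //; exists lambda; split=> //.
    by exists eps, alpha, beta', rho0, sigma', c', d', e1, e2, e3.
  case=> n_even [lambda [BE [eps [alpha [beta [rho0 [sigma [c' [d' [e1 [e2 [e3 fam]]]]]]]]]]]].
  split; last exact: scalar_family_chiral_blocks fam.
  have [_ fam'] := (scalar_family_corner g_lin g_cliff lambda eps alpha beta rho0 sigma
    c' d' e1 e2 e3 rho n_even).1 fam.
  exact: corner_family_rep fam'.
- split=> [[rho_rep e0]|]; first exact: fwd.
  case=> n_even [lambda [BE [eps [alpha [rho0 [beta [sigma [c' [d' [e1 [e2 [e3 fam]]]]]]]]]]]].
  exact: corner_family_rep fam.
Qed.
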